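(* (Replace expansion.) For all $u\ge0$, \begin{align*} \psi_\epsilon(u)=\psi_0(u)&+\theta\sum_{n=1}^\infty\left(\frac{\epsilon}{1-\delta}\right)^n\sum_{k=0}^{n-1}\binom{n-1}{k}\theta^k(-\delta)^{n-1-k}\big(L_{n,k+1,n-1-k}(u)-L_{n-1,k,n-1-k}(u)\big)\\ &-\delta\sum_{n=1}^\infty\left(\frac{\epsilon}{1-\delta}\right)^n\sum_{k=0}^{n-1}\binom{n-1}{k}\theta^k(-\delta)^{n-1-k}\big(L_{n,k,n-k}(u)-L_{n-1,k,n-1-k}(u)\big), \end{align*} where $L_{s,m,r}(u)=\mathbb{P}(M_{0,0}+M_{0,1}+\dots+M_{0,s}+C^e_1+\dots+C^e_m+B^e_1+\dots+B^e_r>u)$ and $L_{0,0,0}(u)=\psi_0(u)$. A sufficient condition for the convergence of this series expansion for all values of $u$ is $\epsilon<|1-\delta|/\max\{\delta,\theta\}$ (that is, under this condition the series converges and the expansion is valid for all $u$).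
   Context: Fix $\lambda>0$ and $\epsilon\in[0,1]$. Let $B$ be a nonnegative random variable with a phase-type distribution and $C$ a nonnegative random variable with a heavy-tailed distribution ($\mathbb{E}e^{rC}=\infty$ for all $r>0$), both with finite positive means. Classical Cramér–Lundberg model: premiums flow in at rate 1, claims arrive according to a Poisson process $\{N_\epsilon(t)\}$ of rate $\lambda$, and the claim sizes $U_{\epsilon,i}$ are i.i.d., independent of $N_\epsilon$, distributed as $B$ with probability $1-\epsilon$ and as $C$ with probability $\epsilon$. Let $M_\epsilon=\sup_{t\ge0}\big(\sum_{i=1}^{N_\epsilon(t)}U_{\epsilon,i}-t\big)$ and let $\psi_\epsilon(u)=\mathbb{P}(M_\epsilon>u)$ be the ruin probability with initial capital $u\ge0$. Put $\delta=\lambda\mathbb{E}B$, $\theta=\lambda\mathbb{E}C$, $\rho_\epsilon=(1-\epsilon)\delta+\epsilon\theta$. Standing assumptions: $\rho_\epsilon<1$ and $\delta<1$. For a nonnegative random variable with distribution $F$ and mean $\mu_F\in(0,\infty)$, its stationary excess distribution is $F^e(u)=\frac1{\mu_F}\int_0^u(1-F(t))\,dt$; $B^e$, $C^e$ have the stationary excess distributions of $B$, $C$. Replace base model: $M_0$ and $\psi_0(u)=\mathbb{P}(M_0>u)$ are $M_\epsilon$ and $\psi_\epsilon$ for $\epsilon=0$ (all claims distributed as $B$, arrival rate $\lambda$). The $M_{0,i}$, $C^e_i$, $B^e_i$ are copies of $M_0$, $C^e$, $B^e$ respectively, all mutually independent. *)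

(* Defs.v *)
From HB Require Import structures.
From mathcomp Require Import all_boot all_order all_algebra.
From mathcomp Require Import finmap.
From mathcomp Require Import all_classical all_reals all_analysis.
From mathcomp Require Import measurable_realfun random_variable exponential_distribution.

Set Implicit Arguments.
Unset Strict Implicit.
Unset Printing Implicit Defensive.

Import Order.TTheory GRing.Theory Num.Theory.
Import numFieldNormedType.Exports.

Local Open Scope classical_set_scope.
Local Open Scope ring_scope.

(* Mutual independence, as the product rule over all finite subfamilies. *)
Definition independent_RVs d (Omega : measurableType d) (R : realType)
    (P : probability Omega R) (I : choiceType) (X : I -> {RV P >-> R}) : Prop :=
  forall (J : {fset I}) (A : I -> set R),
    (forall i, i \in J -> measurable (A i)) ->
    P (\bigcap_(i in [set` J]) (X i @^-1` A i)) =
    (\prod_(i <- J) P (X i @^-1` A i))%E.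

Definition mxexp (R : realType) (n : nat) (A : 'M[R]_n) : 'M[R]_n :=
  \matrix_(i, j) limn (series (fun k : nat => (A ^+ k) i j / k`!%:R)).

(* X is the absorption time of a Markov jump process with n transient states,
   initial law alpha on them and sub-intensity matrix T.  The mass missing from
   alpha is an atom at 0; invertibility of T says that absorption is certain. *)
Definition phase_type d (Omega : measurableType d) (R : realType)
    (P : probability Omega R) (X : {RV P >-> R}) : Prop :=
  exists (n : nat) (alpha : 'rV[R]_n) (T : 'M[R]_n),
    [/\ (forall i, 0 <= alpha 0 i) /\ \sum_i alpha 0 i <= 1,
        forall i j, i != j -> 0 <= T i j,
        forall i, \sum_j T i j <= 0,
        T \in unitmx &
        forall x : R, 0 <= x ->
          ccdf X x = ((alpha *m mxexp (x *: T) *m (const_mx 1 : 'cV_n)) 0 0)%:E].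

Definition heavy_tailed d (Omega : measurableType d) (R : realType)
    (P : probability Omega R) (X : {RV P >-> R}) : Prop :=
  forall r : R, 0 < r -> ('M_P X r = +oo)%E.

Definition stationary_excess d (Omega : measurableType d) (R : realType)
    (P : probability Omega R) (X Xe : {RV P >-> R}) : Prop :=
  forall u : R, 0 <= u ->
    cdf Xe u = ((fine 'E_P[X])^-1%:E *
      \int[lebesgue_measure]_(t in `[0%R, u]) (1 - cdf X t))%E.

Definition same_law d (Omega : measurableType d) (R : realType)
    (P : probability Omega R) (X Y : Omega -> \bar R) : Prop :=
  forall A : set (\bar R), measurable A -> P (X @^-1` A) = P (Y @^-1` A).

(* N is the counting process of the renewal epochs T 0 + ... + T (n - 1),
   n >= 1.  As N takes its values in nat, the epochs are unbounded on every
   path. *)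
Definition counts (Omega : Type) (R : realType) (T : nat -> Omega -> R)
    (N : R -> Omega -> nat) : Prop :=
  forall (t : R) (w : Omega) (n : nat), 0 <= t ->
    (n <= N t w)%N = (\sum_(i < n) T i w <= t).

Definition join2 (I J T : Type) (X : I -> T) (Y : J -> T) (k : I + J) : T :=
  match k with inl i => X i | inr j => Y j end.

(* N is a Poisson process of rate lambda, i.e. it counts the partial sums of
   i.i.d. exponential interarrival times T; the claim sizes U are i.i.d. with
   the (1 - eps, eps)-mixture of the laws of B and C, and independent of N,
   i.e. of the interarrival times. *)
Definition cramer_lundberg d (Omega : measurableType d) (R : realType)
    (P : probability Omega R) (lambda eps : R) (B C : {RV P >-> R})
    (N : R -> Omega -> nat) (U : nat -> {RV P >-> R}) : Prop :=
  exists T : nat -> {RV P >-> R},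
    [/\ independent_RVs (join2 T U),
        forall i (A : set R), measurable A ->
          distribution P (T i) A = exponential_prob lambda A,
        counts (fun i => T i : Omega -> R) N &
        forall i (A : set R), measurable A ->
          distribution P (U i) A =
          ((1 - eps)%:E * distribution P B A + eps%:E * distribution P C A)%E].

Definition max_loss (Omega : Type) (R : realType) (N : R -> Omega -> nat)
    (U : nat -> Omega -> R) (w : Omega) : \bar R :=
  ereal_sup [set (\sum_(i < N t w) U i w - t)%:E | t in [set t : R | 0 <= t]].

Definition ruin_prob d (Omega : measurableType d) (R : realType)
    (P : probability Omega R) (N : R -> Omega -> nat) (U : nat -> Omega -> R)
    (u : R) : R :=
  fine (P [set w | (u%:E < max_loss N U w)%E]).

(* P (X_0 + ... + X_s + Y_1 + ... + Y_m + Z_1 + ... + Z_r > u), with the Y's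
   and Z's numbered from 0. *)
Definition sum_tail d (Omega : measurableType d) (R : realType)
    (P : probability Omega R) (X Y Z : nat -> Omega -> R) (s m r : nat)
    (u : R) : R :=
  fine (P [set w | u < \sum_(i < s.+1) X i w + \sum_(i < m) Y i w +
                       \sum_(i < r) Z i w]).

(* Main.v *)
(* M_eps is the maximum of the random walk with steps U_i - T_i.  Decomposing the
   (n+1)-step maximum at the first step, integrating over [0, u], and letting n
   and then u go to infinity gives the Pollaczek-Khinchine equation
     phi = (1 - rho) 1 + lambda int_0^u phi (u - y) P (U > y) dy
   for the distribution function phi of M_eps.

   In the convolution algebra of measures on the half-line, with b, c the laws of
   B^e, C^e and m0 the law of M_0, this reads m0 = (1 - delta) (1 - delta b)^-1 and
     m_eps = (1 - rho) (1 - delta b - eps (theta c - delta b))^-1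
           = (1 - eta (theta - delta)) sum_n eta^n m0^(n+1) (theta c - delta b)^n,
   where eta = eps / (1 - delta); regrouping consecutive terms yields the two
   series of the expansion.  Since theta c and delta b have densities bounded by
   lambda, convolution with either of them has norm at most lambda / s for the
   weight exp (- s u), so that at a fixed level u every series converges
   geometrically once s is large. *)

Require Import Defs.
From HB Require Import structures.
From mathcomp Require Import all_boot all_order all_algebra.
From mathcomp Require Import finmap.
From mathcomp Require Import all_classical all_reals all_analysis.
From mathcomp Require Import measurable_realfun random_variable exponential_distribution.
From mathcomp Require Import ring lra.

Set Implicit Arguments.
Unset Strict Implicit.
Unset Printing Implicit Defensive.

Import Order.TTheory GRing.Theory Num.Theory.
Import numFieldNormedType.Exports.

Local Open Scope classical_set_scope.
Local Open Scope ring_scope.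

(** * Independence *)

(** The convolution algebra is never built. A measure is represented by its distribution function
    and convolution with theta c or delta b by [lam * renewal g], where [g] is the survival function
    of C or B, so each algebraic identity becomes an integral equation. Inversion is replaced by
    uniqueness: the partial sums [kappa * Psi n] solve the renewal equation of phi up to a residue,
    and the difference is small because the operator contracts in the weighted norm.

    In the Pollaczek-Khinchine equation, integrating out the first exponential interarrival time
    leaves the weight exp (- lam (y - v)^+). As a function of v it solves f' = lam f below y and is
    constant above y. Integrating over v exploits this without differentiating a distribution
    function, whose smoothness is unknown. The price is that the atom at 0 appears as an unknown; it
    is then determined by two inequalities, one valid at every finite n, the other obtained from the
    limit equation as u grows. *)

Section independence.
Context d (Omega : measurableType d) (R : realType) (P : probability Omega R).

Definition indep2 d1 d2 (T1 : measurableType d1) (T2 : measurableType d2)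
    (X : Omega -> T1) (Y : Omega -> T2) :=
  forall A B, measurable A -> measurable B ->
    P (X @^-1` A `&` Y @^-1` B) = (P (X @^-1` A) * P (Y @^-1` B))%E.

(** Finite cylinder events: a pi-system generating the sigma-algebra of the variables indexed by
    [K], on which [independent_RVs] gives the product rule directly. *)
Definition rectangles (I : choiceType) (X : I -> {RV P >-> R}) (K : set I) :
    set (set Omega) :=
  [set E | exists (J : {fset I}) (A : I -> set R),
    [/\ [set` J] `<=` K, forall i, measurable (A i) &
        E = \bigcap_(i in [set` J]) (X i @^-1` A i)]].

Section rectangles_theory.
Context (I : choiceType) (X : I -> {RV P >-> R}) (K : set I).

Lemma rectangles_measurable : rectangles X K `<=` measurable.
Proof.
move=> _ [J [A [_ mA ->]]]; rewrite bigcap_fset.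
by apply: bigsetI_measurable => i _; rewrite -[_ @^-1` _]setTI; exact: measurable_funP.
Qed.

Lemma rectanglesT : rectangles X K setT.
Proof.
exists fset0, (fun=> setT); split => //.
by apply/seteqP; split => w // _ i /=; rewrite inE.
Qed.

Lemma rectangles_setI_closed : setI_closed (rectangles X K).
Proof.
move=> _ _ [J [A [JK mA ->]]] [J' [A' [JK' mA' ->]]].
exists (J `|` J')%fset, (fun i => (if i \in J then A i else setT) `&`
                                  (if i \in J' then A' i else setT)).
split.
- by move=> i /=; rewrite inE => /orP[iJ|iJ']; [exact: JK|exact: JK'].
- by move=> i; apply: measurableI; case: ifP.
- apply/seteqP; split => [w [wA wA'] i /= _|w wAA']; last split => i /= iJ.
  + by split; case: ifP => // ?; [exact: wA|exact: wA'].
  + by have /= := wAA' i; rewrite !inE iJ => /(_ isT) [].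
  + by have /= := wAA' i; rewrite !inE iJ orbT => /(_ isT) [].
Qed.

Lemma sub_sigma_rectangles (E : set Omega) : <<s rectangles X K >> E -> measurable E.
Proof.
apply: smallest_sub; [exact: sigma_algebra_measurable|exact: rectangles_measurable].
Qed.

Lemma measurable_fun_sub_sigma d' (T' : measurableType d') (Z : Omega -> T') :
  measurable_fun (setT : set (g_sigma_algebraType (rectangles X K))) Z ->
  measurable_fun (setT : set Omega) Z.
Proof.
by move=> mZ _ B mB; apply: sub_sigma_rectangles; exact: (mZ measurableT B mB).
Qed.

Lemma measurable_fun_sigma_rectangles i : K i ->
  measurable_fun (setT : set (g_sigma_algebraType (rectangles X K))) (X i).
Proof.
move=> Ki _ B mB; apply: sub_sigma_algebra.
exists [fset i]%fset, (fun=> B); split => //.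
- by move=> j /=; rewrite inE => /eqP ->.
- rewrite setTI; apply/seteqP.
  by split => [w XB j /=|w /(_ i) /=]; rewrite inE ?eqxx; [move/eqP ->|exact].
Qed.

(** With the event of [X k] fixed, both sides are finite measures of the event of [Z], namely a
    restriction and a multiple of [P], so agreement on the pi-system of rectangles suffices. Any
    functional of the variables in [K] qualifies as [Z], including those defined by recursion. *)
Lemma indep_sigma_rectangles k d' (T' : measurableType d') (Z : Omega -> T') :
  independent_RVs X -> ~ K k ->
  measurable_fun (setT : set (g_sigma_algebraType (rectangles X K))) Z ->
  indep2 (X k) Z.
Proof.
move=> indX Kk mZ A B mA mB.
have mXA : measurable (X k @^-1` A).
  by rewrite -[_ @^-1` _]setTI; exact: measurable_funP.
have sZB : <<s rectangles X K >> (Z @^-1` B).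
  by have := mZ measurableT B mB; rewrite setTI.
have r0 : (0 <= fine (P (X k @^-1` A)))%R by exact: fine_ge0.
pose r := NngNum r0.
have -> : (P (X k @^-1` A) * P (Z @^-1` B))%E = mscale r P (Z @^-1` B).
  by rewrite /mscale/= fineK// fin_num_measure.
rewrite setIC.
rewrite -[LHS]/(mrestr P mXA (Z @^-1` B)).
apply: (g_sigma_algebra_measure_unique (rectangles X K) rectangles_measurable
  (fun=> setT) (fun=> rectanglesT)) => //.
- by rewrite bigcup_const.
- exact: rectangles_setI_closed.
- move=> _ [J [C [JK mC ->]]].
  set E := \bigcap_(i in _) _.
  change (P (E `&` X k @^-1` A) = (fine (P (X k @^-1` A)))%:E * P E)%E.
  rewrite fineK ?fin_num_measure// indX//.
  have kJ : k \notin J by apply: contra_notN Kk; exact: JK.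
  (* Since [k] is not in [J], intersecting a rectangle over [J] with the event of [X k] gives a
     rectangle over one more index, to which the product rule applies. *)
  pose C' i := if i == k then A else C i.
  have := indX (k |` J)%fset C' (fun i _ => _).
  have C'k : C' k = A by rewrite /C' eqxx.
  rewrite big_fsetU1//= C'k => indk.
  transitivity (P (\bigcap_(i in [set` (k |` J)%fset]) X i @^-1` C' i)); last first.
    rewrite indk => [|i]; last by rewrite /C'; case: ifP.
    congr (_ * _)%E; rewrite !big_seq; apply: eq_bigr => i iJ.
    by rewrite /C'; case: eqP => // ik; rewrite -ik iJ in kJ.
  congr (P _); apply/seteqP; split => w.
    move=> [wC wA] i /=; rewrite !inE /C'; case: eqP => [->//|_ /= iJ].
    exact: wC.
  move=> wC'; split => [i /= iJ|].
    have /= := wC' i; rewrite !inE iJ orbT /C' => /(_ isT).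
    by case: eqP => // ik; rewrite -ik iJ in kJ.
  by have /= := wC' k; rewrite !inE /C' eqxx => /(_ isT).
- move=> n; change (P (setT `&` X k @^-1` A) < +oo)%E.
  by rewrite setTI ltey_eq fin_num_measure.
Qed.

End rectangles_theory.

(** The joint law of an independent pair is the product of its marginals. This carries equality in
    law through the recursion that defines the walk maximum. *)
Lemma joint_law_unique (X X' Y Y' : Omega -> R) (C : set (R * R)) :
  measurable_fun setT X -> measurable_fun setT X' ->
  measurable_fun setT Y -> measurable_fun setT Y' ->
  indep2 X Y -> indep2 X' Y' ->
  (forall A, measurable A -> P (X @^-1` A) = P (X' @^-1` A)) ->
  (forall A, measurable A -> P (Y @^-1` A) = P (Y' @^-1` A)) ->
  measurable C ->
  P ((fun w => (X w, Y w)) @^-1` C) = P ((fun w => (X' w, Y' w)) @^-1` C).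
Proof.
move=> mX mX' mY mY' indXY indXY' lawX lawY mC.
pose fX : {mfun Omega >-> R} := HB.pack X (isMeasurableFun.Build _ _ _ _ _ mX).
pose fY : {mfun Omega >-> R} := HB.pack Y (isMeasurableFun.Build _ _ _ _ _ mY).
have mXY : measurable_fun setT (fun w => (X w, Y w)) by exact: measurable_fun_pair.
have mXY' : measurable_fun setT (fun w => (X' w, Y' w)) by exact: measurable_fun_pair.
pose fXY : {mfun Omega >-> (R * R)%type} :=
  HB.pack (fun w => (X w, Y w)) (isMeasurableFun.Build _ _ _ _ _ mXY).
pose fXY' : {mfun Omega >-> (R * R)%type} :=
  HB.pack (fun w => (X' w, Y' w)) (isMeasurableFun.Build _ _ _ _ _ mXY').
have uniq := @product_measure_unique _ _ _ _ R (distribution P fX) (distribution P fY).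
transitivity ((distribution P fX \x distribution P fY)%E C).
  by rewrite (uniq (distribution P fXY)) => // A B mA mB; exact: indXY.
rewrite (uniq (distribution P fXY')) => // A B mA mB.
transitivity (P (X' @^-1` A) * P (Y' @^-1` B))%E; first exact: indXY'.
by congr (_ * _)%E; apply/esym; [exact: lawX|exact: lawY].
Qed.

(** Fubini for the law of the pair, pulled back to [Omega]: the inner integral averages over [X]
    with the value of [Y] frozen, which stands in for conditioning on [Y]. *)
Lemma indep2_integral (X Y : Omega -> R) (f : R * R -> \bar R) :
  measurable_fun setT X -> measurable_fun setT Y -> indep2 X Y ->
  measurable_fun setT f -> (forall z, 0 <= f z)%E ->
  (\int[P]_w f (X w, Y w) = \int[P]_w \int[P]_w' f (X w', Y w))%E.
Proof.
move=> mX mY indXY mf f0.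
pose fX : {mfun Omega >-> R} := HB.pack X (isMeasurableFun.Build _ _ _ _ _ mX).
pose fY : {mfun Omega >-> R} := HB.pack Y (isMeasurableFun.Build _ _ _ _ _ mY).
have mXY : measurable_fun setT (fun w => (X w, Y w)) by exact: measurable_fun_pair.
pose fXY : {mfun Omega >-> (R * R)%type} :=
  HB.pack (fun w => (X w, Y w)) (isMeasurableFun.Build _ _ _ _ _ mXY).
have uniq := @product_measure_unique _ _ _ _ R (distribution P fX) (distribution P fY).
transitivity (\int[distribution P fXY]_z f z)%E.
  by rewrite ge0_integral_distribution.
rewrite (eq_measure_integral (distribution P fX \x distribution P fY)%E); last first.
  move=> A mA _; apply/esym/(uniq (distribution P fXY)) => // B C mB mC; exact: indXY.
rewrite fubini_tonelli2//= ge0_integral_distribution//=; last 2 first.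
- exact: measurable_fun_fubini_tonelli_G.
- by move=> y; apply: integral_ge0.
apply: eq_integral => w _ /=; rewrite /fubini_G ge0_integral_distribution//.
by apply: measurableT_comp => //; exact: measurable_pair2.
Qed.

End independence.

(** * Distribution functions and the renewal operator *)

Lemma measurable_fun_natr d (T : measurableType d) (R : realType)
    (b : T -> bool) :
  measurable_fun setT b -> measurable_fun setT (fun x => (b x)%:R : R).
Proof.
move=> mb; rewrite (_ : (fun _ => _) = (fun x => if b x then 1 else 0)).
  exact: measurable_fun_ifT.
by apply/funext => x; case: (b x).
Qed.

Section renewal_operator.
Context (R : realType).
Notation mu := (@lebesgue_measure R).
Implicit Types (g F : R -> R) (u v y : R).

Definition unit_valued F := measurable_fun setT F /\ forall x, 0 <= F x <= 1.

Definition vanish_neg F := forall v, v < 0 -> F v = 0.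

Definition heaviside v : R := (0 <= v)%R%:R.

(** For [F] vanishing on negative arguments, the convolution of [F] with the measure of density [g]
    on the half-line. Cutting at [u] keeps the integral finite for bounded [g] and [F], even if [g]
    has infinite mass. *)
Definition renewal g F u : R := \int[mu]_(y in `[0, u]) (g y * F (u - y)).

Lemma unit_valued_heaviside : unit_valued heaviside.
Proof.
split; first by apply: measurable_fun_natr; exact: measurable_fun_ler.
by move=> x; rewrite /heaviside; case: (0 <= x); rewrite ?lexx ler01.
Qed.

Lemma vanish_neg_heaviside : vanish_neg heaviside.
Proof. by move=> v v0; rewrite /heaviside leNgt v0. Qed.

Lemma integral_cst_itv (c u : R) : 0 <= u ->
  (\int[mu]_(y in `[0%R, u]) c%:E = (c * u)%:E)%E.
Proof.
move=> u0; rewrite integral_cst//= lebesgue_measure_itv/= lte_fin.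
by case: ltgtP u0 => // [_ _|<- _]; rewrite ?sube0// mulr0 mule0.
Qed.

Lemma renewal_neg g F u : u < 0 -> renewal g F u = 0.
Proof. by move=> u0; rewrite /renewal set_itv_ge ?Rintegral_set0// bnd_simp -ltNge. Qed.

Lemma renewalE g F u : unit_valued g -> unit_valued F ->
  (renewal g F u)%:E = (\int[mu]_(y in `[0%R, u]) (g y * F (u - y))%:E)%E.
Proof.
move=> [mg g01] [mF F01]; rewrite /renewal /Rintegral fineK//.
have gF0 y : 0 <= g y * F (u - y).
  by have /andP[? _] := g01 y; have /andP[? _] := F01 (u - y); exact: mulr_ge0.
have mgF : measurable_fun setT (fun y => g y * F (u - y)).
  apply: measurable_funM => //; apply: measurableT_comp => //.
  exact: measurable_funB.
rewrite ge0_fin_numE; last by apply: integral_ge0 => y _; rewrite lee_fin.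
have [u0|u0] := leP 0 u; last first.
  by rewrite set_itv_ge ?integral_set0// bnd_simp -ltNge.
apply: (@le_lt_trans _ _ (\int[mu]_(y in `[0%R, u]) 1%:E)%E); last first.
  by rewrite integral_cst_itv// mul1r ltry.
apply: ge0_le_integral => //=.
- by move=> y _; rewrite lee_fin.
- by apply/measurable_EFinP; exact: measurable_funTS.
- move=> y _; rewrite lee_fin.
  have /andP[? ?] := g01 y; have /andP[? ?] := F01 (u - y).
  by rewrite -[leRHS]mulr1 ler_pM.
Qed.

(** Over the whole line the integrand is jointly measurable in [u] and [y], as Tonelli requires:
    [heaviside] cuts at 0, and the vanishing of [F] cuts at [u]. *)
Lemma renewalTE g F u : unit_valued g -> unit_valued F -> vanish_neg F ->
  (renewal g F u)%:E = (\int[mu]_y (heaviside y * g y * F (u - y))%:E)%E.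
Proof.
move=> gu Fu Fneg; rewrite renewalE// [LHS]integral_mkcond.
apply: eq_integral => y _; rewrite patchE mem_setE in_itv/= /heaviside.
case: (leP 0 y) => y0 /=; last by rewrite !mul0r.
case: leP => uy; first by rewrite mul1r.
by rewrite Fneg ?subr_lt0// mulr0.
Qed.

Lemma measurable_renewal g F : unit_valued g -> unit_valued F -> vanish_neg F ->
  measurable_fun setT (renewal g F).
Proof.
move=> gu Fu Fneg; apply/measurable_EFinP.
rewrite (_ : _ \o _ = fubini_F mu (fun z : R * R =>
   (heaviside z.2 * g z.2 * F (z.1 - z.2))%:E)); last first.
  by apply/funext => u; rewrite /fubini_F -renewalTE.
apply: measurable_fun_fubini_tonelli_F.
- apply/measurable_EFinP; apply: measurable_funM; last first.
    by apply: measurableT_comp; [exact: Fu.1|exact: measurable_funB].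
  apply: measurable_funM; apply: measurableT_comp => //.
  + exact: unit_valued_heaviside.1.
  + exact: gu.1.
- move=> z; rewrite lee_fin.
  have /andP[? _] := gu.2 z.2; have /andP[? _] := Fu.2 (z.1 - z.2).
  have /andP[? _] := unit_valued_heaviside.2 z.2.
  by rewrite !mulr_ge0.
Qed.

End renewal_operator.
Arguments heaviside {R} v.
Arguments unit_valued_heaviside {R}.
Arguments vanish_neg_heaviside {R}.

(** * Distribution functions of sums of independent variables *)

Section distribution_functions.
Context d (Omega : measurableType d) (R : realType) (P : probability Omega R).
Notation mu := (@lebesgue_measure R).
Implicit Types (X S : Omega -> R) (u v : R).

Definition cdfr X u : R := fine (P [set w | X w <= u]).

Lemma measurable_le_set X u : measurable_fun setT X -> measurable [set w | X w <= u].
Proof.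
move=> mX; rewrite [X in measurable X](_ : _ = setT `&` X @^-1` `]-oo, u]).
  exact: mX.
by rewrite setTI; apply/seteqP; split => w /=; rewrite in_itv.
Qed.

Lemma cdfrE X u : measurable_fun setT X -> (cdfr X u)%:E = P [set w | X w <= u].
Proof. by move=> mX; rewrite fineK// fin_num_measure//; exact: measurable_le_set. Qed.

Lemma cdfr_integral X u : measurable_fun setT X ->
  (cdfr X u)%:E = (\int[P]_w (X w <= u)%R%:R%:E)%E.
Proof.
move=> mX; rewrite cdfrE// -[[set w | _]]setIT.
rewrite -integral_indic//; last exact: measurable_le_set.
by apply: eq_integral => w _; rewrite indicE mem_setE.
Qed.

Lemma cdfr_nondecreasing X : measurable_fun setT X -> nondecreasing (cdfr X).
Proof.
move=> mX u v uv; rewrite -lee_fin !cdfrE//.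
by apply: le_measure; rewrite ?inE; [exact: measurable_le_set..|move=> w /= /le_trans; exact].
Qed.

Lemma unit_valued_cdfr X : measurable_fun setT X -> unit_valued (cdfr X).
Proof.
move=> mX; split; first by apply: nondecreasing_measurable => //; exact: cdfr_nondecreasing.
move=> u; rewrite -!lee_fin cdfrE// measure_ge0 /=.
by apply: probability_le1; exact: measurable_le_set.
Qed.

Lemma vanish_neg_cdfr X : measurable_fun setT X -> {ae P, forall w, 0 <= X w} ->
  vanish_neg (cdfr X).
Proof.
move=> mX X0 v v0; rewrite /cdfr.
rewrite (measure_negligible _ _) //; first exact: measurable_le_set.
apply: negligibleS X0 => w /= Xv; apply/negP; rewrite -ltNge.
exact: le_lt_trans v0.
Qed.

Lemma cdfr_add X S u : measurable_fun setT X -> measurable_fun setT S ->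
  indep2 P X S ->
  (cdfr (S \+ X) u)%:E = (\int[P]_w (cdfr X (u - S w))%:E)%E.
Proof.
move=> mX mS indXS; rewrite cdfr_integral; last exact: measurable_funD.
rewrite (indep2_integral (f := fun z => (z.2 + z.1 <= u)%R%:R%:E) mX mS indXS)//=.
  apply: eq_integral => w _; rewrite cdfr_integral//.
  by apply: eq_integral => w' _; rewrite lerBrDl.
apply/measurable_EFinP; apply: measurable_fun_natr; apply: measurable_fun_ler => //.
exact: measurable_funD.
Qed.

(** Convolution of [F] with the law of [S], written as an expectation. *)
Definition shift_mean S (F : R -> R) v : R := fine (\int[P]_w (F (v - S w))%:E)%E.

Section shift_mean.
Context (S : Omega -> R) (F : R -> R).
Hypotheses (mS : measurable_fun setT S) (Fu : unit_valued F).

Let mFS : measurable_fun setT (fun z : Omega * R => (F (z.2 - S z.1))%:E).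
Proof.
apply/measurable_EFinP; apply: measurableT_comp; first exact: Fu.1.
by apply: measurable_funB => //; exact: measurableT_comp.
Qed.

Let FS0 (z : Omega * R) : (0 <= (F (z.2 - S z.1))%:E)%E.
Proof. by have /andP[? _] := Fu.2 (z.2 - S z.1); rewrite lee_fin. Qed.

Lemma shift_mean_le1 v : (0 <= \int[P]_w (F (v - S w))%:E <= 1)%E.
Proof.
apply/andP; split; first by apply: integral_ge0 => w _; exact: (FS0 (w, v)).
apply: (@le_trans _ _ (\int[P]_w (cst 1%:E w))%E); last first.
  by rewrite integral_cst// mul1e probability_le1.
apply: ge0_le_integral => //.
- by move=> w _; exact: (FS0 (w, v)).
- exact: (measurableT_comp mFS (measurable_pair2 v)).
- by move=> w _; rewrite lee_fin; have /andP[] := Fu.2 (v - S w).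
Qed.

Lemma shift_meanE v : (shift_mean S F v)%:E = (\int[P]_w (F (v - S w))%:E)%E.
Proof.
have /andP[? v1] := shift_mean_le1 v.
by rewrite fineK// ge0_fin_numE// (le_lt_trans v1)// ltry.
Qed.

Lemma unit_valued_shift_mean : unit_valued (shift_mean S F).
Proof.
split.
  apply/measurable_EFinP.
  rewrite (_ : _ \o _ = fubini_G P (fun z : Omega * R => (F (z.2 - S z.1))%:E)).
    exact: measurable_fun_fubini_tonelli_G.
  by apply/funext => v; rewrite /= shift_meanE.
by move=> v; rewrite -!lee_fin shift_meanE; exact: shift_mean_le1.
Qed.

Lemma vanish_neg_shift_mean : vanish_neg F -> {ae P, forall w, 0 <= S w} ->
  vanish_neg (shift_mean S F).
Proof.
move=> Fneg S0 v v0; rewrite /shift_mean.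
rewrite (ae_eq_integral (cst 0%E)) ?integral_cst ?mul0e//.
- exact: (measurableT_comp mFS (measurable_pair2 v)).
- apply: filterS S0 => w Sw _ /=.
  by rewrite Fneg// subr_lt0 (lt_le_trans v0).
Qed.

(** Convolution with the density [g] commutes with convolution with the law of [S]; by Tonelli, once
    both integrals run over full spaces. *)
Lemma renewal_shift_mean g u : unit_valued g -> vanish_neg F ->
  {ae P, forall w, 0 <= S w} ->
  (\int[P]_w (renewal g F (u - S w))%:E = (renewal g (shift_mean S F) u)%:E)%E.
Proof.
move=> gu Fneg S0.
have gu0 y : 0 <= heaviside y * g y.
  have /andP[? _] := gu.2 y; have /andP[? _] := unit_valued_heaviside.2 y.
  exact: mulr_ge0.
rewrite renewalTE//; [|exact: unit_valued_shift_mean|exact: vanish_neg_shift_mean].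
pose f (z : Omega * R) := (heaviside z.2 * g z.2 * F (u - z.2 - S z.1))%:E.
transitivity (\int[P]_w \int[mu]_y f (w, y))%E.
  apply: eq_integral => w _; rewrite renewalTE//.
  by apply: eq_integral => y _; rewrite /f /= addrAC.
rewrite (@fubini_tonelli _ _ _ _ R P mu f)//=; last 2 first.
- apply/measurable_EFinP; apply: measurable_funM.
    apply: measurable_funM; apply: measurableT_comp => //.
    + exact: unit_valued_heaviside.1.
    + exact: gu.1.
  apply: measurableT_comp; first exact: Fu.1.
  apply: measurable_funB; last exact: measurableT_comp.
  exact: measurable_funB.
- move=> z; rewrite lee_fin mulr_ge0//.
  by have /andP[] := Fu.2 (u - z.2 - S z.1).
apply: eq_integral => y _; rewrite EFinM shift_meanE -ge0_integralZl ?lee_fin//.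
- exact: (measurableT_comp mFS (measurable_pair2 (u - y))).
- by move=> w _; exact: (FS0 (w, u - y)).
Qed.

End shift_mean.

Lemma shift_mean_heaviside S : measurable_fun setT S ->
  shift_mean S heaviside = cdfr S.
Proof.
move=> mS; apply/funext => u; apply: EFin_inj.
rewrite shift_meanE//; last exact: unit_valued_heaviside.
by rewrite cdfr_integral//; apply: eq_integral => w _; rewrite /heaviside subr_ge0.
Qed.

Lemma shift_mean_cdfr X S : measurable_fun setT X -> measurable_fun setT S ->
  indep2 P X S -> shift_mean S (cdfr X) = cdfr (S \+ X).
Proof.
move=> mX mS indXS; apply/funext => u; apply: EFin_inj.
by rewrite shift_meanE//; [rewrite cdfr_add|exact: unit_valued_cdfr].
Qed.

Section cdfr_add_renewal.
Context (X S : Omega -> R) (g : R -> R).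
Hypotheses (mX : measurable_fun setT X) (mS : measurable_fun setT S).
Hypotheses (indXS : indep2 P X S) (S0 : {ae P, forall w, 0 <= S w}).
Hypothesis gu : unit_valued g.

(** As [heaviside] is the unit of convolution, the hypothesis on [cdfr X] says that [X] has density
    [c * g] on the half-line; convolving it with the law of [S] gives the claim. *)
Lemma cdfr_add_density c u : 0 <= c ->
  (forall v, cdfr X v = c * renewal g heaviside v) ->
  cdfr (S \+ X) u = c * renewal g (cdfr S) u.
Proof.
move=> c0 XE; apply: EFin_inj; rewrite cdfr_add//.
have hu := @unit_valued_heaviside R; have hn := @vanish_neg_heaviside R.
rewrite -(shift_mean_heaviside mS) EFinM -renewal_shift_mean//.
rewrite -ge0_integralZl ?lee_fin//.
- by apply: eq_integral => w _; rewrite XE EFinM.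
- apply/measurable_EFinP; apply: (measurableT_comp (measurable_renewal gu hu hn)).
  exact: measurable_funB.
- move=> w _; rewrite lee_fin; apply: Rintegral_ge0 => y _.
  have /andP[? _] := gu.2 y; have /andP[? _] := hu.2 (u - S w - y).
  exact: mulr_ge0.
Qed.

(** The renewal equation of [X] is convolved with the law of [S]: the unit becomes [cdfr S], and the
    renewal operator commutes with the convolution. *)
Lemma cdfr_add_renewal a l u : 0 <= a -> 0 <= l ->
  {ae P, forall w, 0 <= X w} ->
  (forall v, cdfr X v = a * heaviside v + l * renewal g (cdfr X) v) ->
  cdfr (S \+ X) u = a * cdfr S u + l * renewal g (cdfr (S \+ X)) u.
Proof.
move=> a0 l0 X0 XE; apply: EFin_inj; rewrite cdfr_add//.
have hu := @unit_valued_heaviside R.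
have Xu := unit_valued_cdfr mX; have Xn := vanish_neg_cdfr mX X0.
rewrite EFinD !EFinM -(shift_mean_heaviside mS) shift_meanE//.
rewrite -(shift_mean_cdfr mX mS indXS) -renewal_shift_mean//.
have mSu : measurable_fun setT (fun w => u - S w) by exact: measurable_funB.
have mh : measurable_fun setT (fun w => (heaviside (u - S w))%:E).
  by apply/measurable_EFinP; apply: (measurableT_comp hu.1).
have mr : measurable_fun setT (fun w => (renewal g (cdfr X) (u - S w))%:E).
  by apply/measurable_EFinP; apply: (measurableT_comp (measurable_renewal gu Xu Xn)).
have h0 w : (0 <= (heaviside (u - S w))%:E)%E.
  by rewrite lee_fin; have /andP[] := hu.2 (u - S w).
have r0 w : (0 <= (renewal g (cdfr X) (u - S w))%:E)%E.
  rewrite lee_fin; apply: Rintegral_ge0 => y _.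
  have /andP[? _] := gu.2 y; have /andP[? _] := Xu.2 (u - S w - y).
  exact: mulr_ge0.
rewrite -!ge0_integralZl ?lee_fin// -ge0_integralD//=.
- by apply: eq_integral => w _; rewrite {1}XE EFinD !EFinM.
- by move=> w _; apply: mule_ge0; [rewrite lee_fin|exact: h0].
- exact: measurable_funeM.
- by move=> w _; apply: mule_ge0; [rewrite lee_fin|exact: r0].
- exact: measurable_funeM.
Qed.

End cdfr_add_renewal.

End distribution_functions.

Section tonelli_on.
Context d (Omega : measurableType d) (R : realType) (P : probability Omega R).
Notation mu := (@lebesgue_measure R).

Lemma tonelli_on (D : set R) (f : Omega * R -> R) : measurable D ->
  measurable_fun setT f -> (forall z, 0 <= f z) ->
  (\int[P]_w \int[mu]_(y in D) (f (w, y))%:E =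
   \int[mu]_(y in D) \int[P]_w (f (w, y))%:E)%E.
Proof.
move=> mD mf f0; pose h (z : Omega * R) := (f z * \1_D z.2)%:E.
have mh : measurable_fun setT h.
  apply/measurable_EFinP; apply: measurable_funM => //.
  by apply: measurableT_comp => //; exact: measurable_indic.
have h0 z : (0 <= h z)%E by rewrite lee_fin mulr_ge0.
have fub := @fubini_tonelli _ _ _ _ R P mu h mh h0.
rewrite [RHS]integral_mkcond.
transitivity (\int[P]_w \int[mu]_y h (w, y))%E.
  apply: eq_integral => w _; rewrite integral_mkcond; apply: eq_integral => y _.
  by rewrite patchE /h indicE /=; case: ifP => _; rewrite ?mulr1 ?mulr0.
rewrite fub; apply: eq_integral => y _; rewrite patchE.
case: ifP => yD; last first.
  by rewrite integral0_eq// => w _; rewrite /h /= indicE yD mulr0.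
by apply: eq_integral => w _; rewrite /h /= indicE yD mulr1.
Qed.

End tonelli_on.

(** * Explicit integrals of indicators and exponentials *)

Section real_integrals.
Context (R : realType).
Notation mu := (@lebesgue_measure R).
Implicit Types (a b u v y : R).

Lemma lebesgue_measure_itvcc a : 0 <= a -> mu `[0, a]%classic = a%:E.
Proof.
move=> a0; rewrite lebesgue_measure_itv/= lte_fin.
by case: ltgtP a0 => // [_ _|<- _]; rewrite ?sube0.
Qed.

Lemma lebesgue_measure_itvco a : 0 <= a -> mu `[0, a[%classic = a%:E.
Proof.
move=> a0; rewrite lebesgue_measure_itv/= lte_fin.
by case: ltgtP a0 => // [_ _|<- _]; rewrite ?sube0.
Qed.

Lemma integral_le_itv a u : 0 <= a -> 0 <= u ->
  (\int[mu]_(y in `[0%R, u]) ((a <= y)%R%:R : R)%:E = (Num.max 0 (u - a))%:E)%E.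
Proof.
move=> a0 u0; rewrite integral_mkcond.
transitivity (\int[mu]_y (\1_`[a, u] y)%:E)%E.
  apply: eq_integral => y _; rewrite patchE mem_setE indicE mem_setE !in_itv/=.
  case: (leP a y) => ay /=; last by case: ifP.
  by rewrite (le_trans a0 ay) /=; case: ifP.
rewrite integral_indic// setIT [LHS]lebesgue_measure_itv/= lte_fin.
by case: (ltP a u) => au; [rewrite max_r// subr_ge0 ltW|rewrite max_l// subr_le0].
Qed.

(** A layer-cake formula: it will turn the product of a survival function and a distribution
    function into the expectation of a minimum. *)
Lemma integral_lt_le_itv a b u : b <= u ->
  (\int[mu]_(y in `[0%R, u]) ((y < a)%R%:R * (y <= b)%R%:R : R)%:E =
   (Num.min (Num.max 0 a) (Num.max 0 b))%:E)%E.
Proof.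
move=> bu; rewrite integral_mkcond.
have [ab|ba] := leP a b.
- transitivity (\int[mu]_y (\1_`[0, a[ y)%:E)%E.
    apply: eq_integral => y _; rewrite patchE mem_setE indicE mem_setE !in_itv/=.
    case: (leP 0 y) => y0 //=; case: (ltP y a) => ya; rewrite ?mul0r; last by case: ifP.
    have yb := le_trans (ltW ya) ab.
    by rewrite yb (le_trans yb bu) mulr1.
  rewrite integral_indic// setIT min_l; last by rewrite le_max2 // lexx.
  have [a0|a0] := leP 0 a; first by rewrite [LHS]lebesgue_measure_itvco// max_r.
  rewrite set_itv_ge ?measure0 ?max_l ?ltW//.
  by rewrite bnd_simp -leNgt ltW.
- transitivity (\int[mu]_y (\1_`[0, b] y)%:E)%E.
    apply: eq_integral => y _; rewrite patchE mem_setE indicE mem_setE !in_itv/=.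
    case: (leP 0 y) => y0 //=; case: (leP y b) => yb; rewrite ?mulr0; last by case: ifP.
    by rewrite (le_trans yb bu) (le_lt_trans yb ba) mulr1.
  rewrite integral_indic// setIT min_r; last by rewrite le_max2 // ltW.
  have [b0|b0] := leP 0 b; first by rewrite [LHS]lebesgue_measure_itvcc// max_r.
  rewrite set_itv_ge ?measure0 ?max_l ?ltW//.
  by rewrite bnd_simp -ltNge.
Qed.

Lemma integral_expR_itv (l c a : R) : 0 <= a ->
  (\int[mu]_(v in `[0%R, a]) (l * expR (l * (v - c)))%:E =
   (expR (l * (a - c)) - expR (l * - c))%:E)%E.
Proof.
rewrite le_eqVlt => /predU1P[<-|a0].
  by rewrite set_itv1 integral_set1 sub0r subrr.
pose F v := expR (l * (v - c)).
have dF v : is_derive v (1 : R) F (l * F v).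
  have dl : is_derive v (1 : R) (fun v : R => l * (v - c)) l.
    by apply: is_derive_eq; rewrite subr0 [_ *: _]mulr1.
  by apply: is_derive_eq; rewrite mulrC.
have cF : continuous F.
  by move=> v; apply: differentiable_continuous; apply/derivable1_diffP; case: (dF v).
rewrite (@continuous_FTC2 R (fun v => l * expR (l * (v - c))) F 0 a)//.
- by rewrite /F sub0r EFinB.
- apply: continuous_subspaceT => v.
  apply: (@continuousM _ R^o (fun=> l) F); first exact: cst_continuous.
  exact: cF.
- split; [by move=> v _; case: (dF v)| |].
  + by apply: cvg_at_right_filter; exact: cF.
  + by apply: cvg_at_left_filter; exact: cF.
- by move=> v _; rewrite derive1E; case: (dF v).
Qed.

(** The function f (v) = exp (- l (y - v)^+) satisfies f' = l f up to y^+ and equals 1 beyond it, so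
    the integral is the increment of f plus [l] times the length of the part of the interval beyond
    y^+. *)
Lemma integral_expR_pos (l y u : R) : 0 < l -> 0 <= u ->
  (\int[mu]_(v in `[0%R, u]) (l * expR (- l * Num.max 0 (y - v)))%:E =
   (expR (- l * Num.max 0 (y - u)) - expR (- l * Num.max 0 y) +
    l * Num.max 0 (u - Num.max 0 y))%:E)%E.
Proof.
move=> l0 u0; set z := Num.max 0 y.
have z0 : 0 <= z by rewrite le_max lexx.
(* For nonnegative [v], [y] may be replaced by its positive part, so that the kink never lies to the
   left of the interval. *)
have zv v : 0 <= v -> Num.max 0 (y - v) = Num.max 0 (z - v).
  move=> v0; rewrite /z; case: (leP 0 y) => // y0.
  by rewrite !max_l// subr_le0 // (le_trans (ltW y0)).
rewrite zv//; under eq_integral.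
  move=> v; rewrite inE/= in_itv/= => /andP[v0 _]; rewrite zv//.
  over.
have [uz|zu] := leP u z.
  rewrite max_r ?subr_ge0// max_l ?subr_le0// mulr0 addr0.
  transitivity (\int[mu]_(v in `[0%R, u]) (l * expR (l * (v - z)))%:E)%E.
    apply: eq_integral => v; rewrite inE/= in_itv/= => /andP[v0 vu].
    by rewrite max_r ?subr_ge0 ?(le_trans vu)// mulNr -mulrN opprB.
  by rewrite integral_expR_itv// !mulNr -!mulrN opprB.
rewrite max_l ?subr_le0 1?ltW// mulr0 expR0 max_r; last by rewrite subr_ge0 ltW.
rewrite (@itv_bndbnd_setU _ _ (BLeft 0) (BRight z) (BRight u)) ?bnd_simp ?(ltW zu)//.
rewrite ge0_integral_setU//=; last 3 first.
- apply/measurable_EFinP/measurable_funTS; apply: measurable_funM => //.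
  apply: measurableT_comp => //; apply: measurable_funM => //.
  by apply: measurable_maxr => //; exact: measurable_funB.
- by move=> v _; rewrite lee_fin mulr_ge0 ?expR_ge0// ltW.
- apply/disj_setPRL => v /=; rewrite !in_itv/= => /andP[zv' _] /andP[_].
  by rewrite leNgt zv'.
rewrite EFinD; congr (_ + _)%E.
  transitivity (\int[mu]_(v in `[0%R, z]) (l * expR (l * (v - z)))%:E)%E.
    apply: eq_integral => v; rewrite inE/= in_itv/= => /andP[v0 vz].
    by rewrite max_r ?subr_ge0// mulNr -mulrN opprB.
  by rewrite integral_expR_itv// subrr mulr0 expR0 mulrN mulNr.
transitivity (\int[mu]_(v in `]z, u]) (cst l%:E v))%E.
  apply: eq_integral => v; rewrite inE/= in_itv/= => /andP[zv' _].
  by rewrite max_l ?subr_le0 1?ltW// mulr0 expR0 mulr1.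
by rewrite integral_cst//= lebesgue_measure_itv/= lte_fin zu -EFinB.
Qed.

Lemma exponential_prob_lt (l x : R) : 0 < l ->
  exponential_prob l `]-oo, x[%classic = (1 - expR (- l * Num.max 0 x))%:E.
Proof.
move=> l0; rewrite /exponential_prob.
have mpdf D : measurable_fun D (EFin \o exponential_pdf l).
  by apply/measurable_EFinP/measurable_funTS; exact: measurable_exponential_pdf.
have [x0|x0] := leP x 0.
  rewrite mulr0 expR0 subrr integral0_eq// => v /=; rewrite in_itv/= => vx.
  by rewrite lt0_exponential_pdf// (lt_le_trans vx).
rewrite integral_itv_bndo_bndc//.
rewrite (@itv_bndbnd_setU _ _ -oo%O (BLeft 0) (BRight x)) ?bnd_simp ?ltW//.
rewrite ge0_integral_setU//=; last 3 first.
- exact: mpdf.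
- by move=> v _; rewrite lee_fin exponential_pdf_ge0// ltW.
- apply/disj_setPRL => v /=; rewrite !in_itv/= => /andP[v0 _].
  by apply/negP; rewrite -leNgt.
rewrite integral0_eq ?add0e => [|v /=]; last first.
  by rewrite in_itv/= => v0; rewrite lt0_exponential_pdf.
by rewrite -/(exponential_prob l `[0, x]%classic) exponential_prob_itv0c.
Qed.

Lemma exponential_prob_le0 (l : R) : 0 < l -> exponential_prob l `]-oo, 0]%classic = 0%E.
Proof.
move=> l0; rewrite /exponential_prob.
have mpdf D : measurable_fun D (EFin \o exponential_pdf l).
  by apply/measurable_EFinP/measurable_funTS; exact: measurable_exponential_pdf.
rewrite -integral_itv_bndo_bndc//.
by rewrite integral0_eq// => v /=; rewrite in_itv/= => v0; rewrite lt0_exponential_pdf.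
Qed.

End real_integrals.

(** * The maximum of the claim surplus walk *)

Section survival_function.
Context d (Omega : measurableType d) (R : realType) (P : probability Omega R).
Implicit Types (X : Omega -> R) (y u : R).

Definition ccdfr X y : R := fine (P [set w | y < X w]).

Lemma measurable_gt_set X y : measurable_fun setT X -> measurable [set w | y < X w].
Proof.
move=> mX; rewrite [X in measurable X](_ : _ = setT `&` X @^-1` `]y, +oo[).
  exact: mX.
by rewrite setTI; apply/seteqP; split => w /=; rewrite in_itv/= andbT.
Qed.

Lemma ccdfrE X y : measurable_fun setT X -> (ccdfr X y)%:E = P [set w | y < X w].
Proof. by move=> mX; rewrite fineK// fin_num_measure//; exact: measurable_gt_set. Qed.

Lemma ccdfr_1_cdfr X y : measurable_fun setT X -> ccdfr X y = 1 - cdfr P X y.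
Proof.
move=> mX; apply: EFin_inj; rewrite ccdfrE// EFinB cdfrE//.
rewrite -probability_setC; last exact: measurable_le_set.
by congr (P _); apply/seteqP; split => w /=; rewrite ltNge => /negP.
Qed.

Lemma unit_valued_ccdfr X : measurable_fun setT X -> unit_valued (ccdfr X).
Proof.
move=> mX; have [mF F01] := unit_valued_cdfr P mX.
rewrite (_ : ccdfr X = fun y => 1 - cdfr P X y); last first.
  by apply/funext => y; exact: ccdfr_1_cdfr.
split; first exact: measurable_funB.
by move=> y; have /andP[F0 F1] := F01 y; rewrite subr_ge0 F1 gerBl F0.
Qed.

End survival_function.

Section running_maximum.
Context (Omega : Type) (R : realType).
Implicit Types (X : nat -> Omega -> R) (n k : nat).

(** The recursion removes the first step, not the last, because the first step is independent of the
    maximum after it. The starting index [k] is a parameter so that this later maximum is again a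
    [runmax]. *)
Fixpoint runmax X n k (w : Omega) : R :=
  if n is m.+1 then Num.max 0 (X k w + runmax X m k.+1 w) else 0.

Lemma runmax_ge0 X n k w : 0 <= runmax X n k w.
Proof. by case: n => //= n; rewrite le_max lexx. Qed.

Lemma runmax_leP X n k w (u : R) :
  runmax X n k w <= u <-> forall j, (j <= n)%N -> \sum_(i < j) X (k + i)%N w <= u.
Proof.
elim: n k u => [|n IH] k u /=.
  split=> [u0 j|/(_ 0%N)]; last by rewrite big_ord0; exact.
  by rewrite leqn0 => /eqP ->; rewrite big_ord0.
rewrite ge_max -lerBrDl; split.
  move=> /andP[u0 /IH H] [|j]; first by rewrite big_ord0.
  rewrite ltnS => /H; rewrite lerBrDl big_ord_recl addn0.
  by under [X in _ -> _ + X <= _]eq_bigr do rewrite lift0 addnS -addSn.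
move=> H; apply/andP; split; first by have := H 0%N isT; rewrite big_ord0.
apply/IH => j jn; have := H j.+1 jn; rewrite lerBrDl big_ord_recl addn0.
by under [X in _ + X <= _ -> _]eq_bigr do rewrite lift0 addnS -addSn.
Qed.

Lemma runmax_nondecreasing X k w : nondecreasing_seq (fun n => runmax X n k w).
Proof.
move=> m n mn; apply/runmax_leP => j jm.
have /runmax_leP : runmax X n k w <= runmax X n k w by [].
by apply; exact: leq_trans mn.
Qed.

End running_maximum.

(** * The integral equation linking successive n-step maxima *)

Section ladder.
Context d (Omega : measurableType d) (R : realType) (P : probability Omega R).
Context (lam : R) (T U : nat -> {RV P >-> R}).
Hypothesis lam_gt0 : 0 < lam.
Hypothesis indTU : independent_RVs (join2 T U).
Hypothesis lawT : forall i (A : set R), measurable A ->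
  distribution P (T i) A = exponential_prob lam A.
Hypothesis lawU : forall i (A : set R), measurable A ->
  P (U i @^-1` A) = P (U 0%N @^-1` A).
Hypothesis U_ge0 : {ae P, forall w, 0 <= U 0%N w}.
Notation mu := (@lebesgue_measure R).

Let X i w := U i w - T i w.
Let M n k := runmax X n k.
(** Everything in the first-step decomposition except [T k], hence independent of it. *)
Let Y n k w := U k w + M n k.+1 w.

Let M_S n k w : M n.+1 k w = Num.max 0 (Y n k w - T k w).
Proof. by rewrite /Y addrAC. Qed.

Let sigma_M (K : set (nat + nat)) n k :
  (forall j, (k <= j)%N -> K (inl j) /\ K (inr j)) ->
  measurable_fun (setT : set (g_sigma_algebraType (rectangles (join2 T U) K))) (M n k).
Proof.
elim: n k => [|n IH] k Kk; first exact: measurable_cst.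
apply: measurable_maxr => //; apply: measurable_funD; last first.
  by apply: IH => j kj; apply: Kk; exact: ltnW.
have [Kl Kr] := Kk k (leqnn k).
apply: measurable_funB.
- exact: (@measurable_fun_sigma_rectangles _ _ _ _ _ (join2 T U) K (inr k) Kr).
- exact: (@measurable_fun_sigma_rectangles _ _ _ _ _ (join2 T U) K (inl k) Kl).
Qed.

Let mM n k : measurable_fun setT (M n k).
Proof. exact: measurable_fun_sub_sigma (@sigma_M setT n k _). Qed.

Let mY n k : measurable_fun setT (Y n k).
Proof. exact: measurable_funD. Qed.

Let indUM n k : indep2 P (U k) (M n k.+1).
Proof.
pose K : set (nat + nat) := [set i | match i with inl _ => True | inr j => (k < j)%N end].
apply: (@indep_sigma_rectangles _ _ _ _ _ (join2 T U) K (inr k)) => //=.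
  by rewrite ltnn.
exact: sigma_M.
Qed.

Let indTY n k : indep2 P (T k) (Y n k).
Proof.
pose K : set (nat + nat) := [set i | match i with inl j => (k < j)%N | inr _ => True end].
apply: (@indep_sigma_rectangles _ _ _ _ _ (join2 T U) K (inl k)) => //=.
  by rewrite ltnn.
apply: measurable_funD; last exact: sigma_M.
exact: (@measurable_fun_sigma_rectangles _ _ _ _ _ (join2 T U) K (inr k)).
Qed.

(** Shift invariance in law, by induction on the number of steps: [joint_law_unique] is applied to
    the claim and the later maximum, then to the interarrival time and [Y]. *)
Let law_M n k (A : set R) : measurable A -> P (M n k @^-1` A) = P (M n k.+1 @^-1` A).
Proof.
elim: n k A => [//|n IH] k A mA.
have lawY B : measurable B -> P (Y n k @^-1` B) = P (Y n k.+1 @^-1` B).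
  move=> mB.
  have mC : measurable ((fun z : R * R => z.1 + z.2) @^-1` B).
    by rewrite -[_ @^-1` _]setTI; apply: measurable_funD.
  have := joint_law_unique (@measurable_funPT _ _ _ _ (U k)) (@measurable_funPT _ _ _ _ (U k.+1))
    (mM n k.+1) (mM n k.+2) (indUM n k) (indUM n k.+1) _ (IH k.+1) mC.
  by move=> H; apply: H => C mC'; rewrite lawU// [RHS]lawU.
have mC : measurable ((fun z : R * R => Num.max 0 (z.2 - z.1)) @^-1` A).
  rewrite -[_ @^-1` _]setTI; apply: measurable_maxr => //.
  exact: measurable_funB.
have lawT' C : measurable C -> P (T k @^-1` C) = P (T k.+1 @^-1` C).
  move=> mC'; have := lawT k mC'; have := lawT k.+1 mC'.
  by rewrite /distribution /pushforward => -> ->.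
have := joint_law_unique (@measurable_funPT _ _ _ _ (T k)) (@measurable_funPT _ _ _ _ (T k.+1))
  (mY n k) (mY n k.+1) (indTY n k) (indTY n k.+1) lawT' lawY mC.
have E j : (fun w => (T j w, Y n j w)) @^-1` ((fun z : R * R => Num.max 0 (z.2 - z.1)) @^-1` A)
    = M n.+1 j @^-1` A.
  by apply/seteqP; split => w; rewrite /preimage /= -M_S.
by rewrite !E.
Qed.

Let F n := cdfr P (M n 0).

Let cdfr_M1 n u : cdfr P (M n 1) u = F n u.
Proof.
congr fine; have := @law_M n 0 `]-oo, u]%classic (measurable_itv _).
have E k : M n k @^-1` `]-oo, u]%classic = [set w | M n k w <= u].
  by apply/seteqP; split => w /=; rewrite in_itv.
by rewrite !E.
Qed.

Let survT k (x : R) : (\int[P]_w ((x <= T k w)%R%:R : R)%:E = (expR (- lam * Num.max 0 x))%:E)%E.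
Proof.
have := lawT k (measurable_itv `]-oo, x[); rewrite exponential_prob_lt// => lawTx.
transitivity (\int[P]_w (\1_(~` (T k @^-1` `]-oo, x[%classic)) w)%:E)%E.
  apply: eq_integral => w _; rewrite indicE (_ : (w \in _) = (x <= T k w))//.
  apply/idP/idP; rewrite inE /= in_itv/= => h; first by rewrite leNgt; apply/negP.
  by apply/negP; rewrite -leNgt.
have mTx : measurable (T k @^-1` `]-oo, x[%classic) by exact: measurable_funPTI.
rewrite integral_indic//; last exact: measurableC.
rewrite setIT [LHS]probability_setC// [P _]lawTx -EFinB.
by rewrite opprB addrC subrK.
Qed.

(* M n.+1 0 <= v means Y n 0 - v <= T 0; integrate out T 0 first. *)
Let F_next n v : 0 <= v ->
  ((F n.+1 v)%:E = \int[P]_w (expR (- lam * Num.max 0 (Y n 0 w - v)))%:E)%E.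
Proof.
move=> v0; rewrite /F cdfr_integral//.
rewrite -(eq_integral _ _ (fun w _ => survT 0 (Y n 0 w - v))).
rewrite -(indep2_integral (f := fun z => ((z.2 - v <= z.1)%R%:R)%:E) _ (mY n 0) (indTY n 0))//=.
- apply: eq_integral => w _; rewrite M_S ge_max v0 /=.
  by rewrite lerBlDr addrC -lerBlDr.
- apply/measurable_EFinP; apply: measurable_fun_natr; apply: measurable_fun_ler => //.
  exact: measurable_funB.
Qed.

(** The quantity common to [int_F_next] and [int_F]; eliminating it removes [Y] from the
    equations. *)
Let J n u := (\int[P]_w (Num.max 0 (u - Num.max 0 (Y n 0 w)))%:E)%E.

Let mexp n v :
  measurable_fun setT (fun w => (expR (- lam * Num.max 0 (Y n 0 w - v)))%:E).
Proof.
apply/measurable_EFinP; apply: measurableT_comp => //; apply: measurable_funM => //.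
by apply: measurable_maxr => //; exact: measurable_funB.
Qed.

Let mJ n u : measurable_fun setT (fun w => (Num.max 0 (u - Num.max 0 (Y n 0 w)))%:E).
Proof.
apply/measurable_EFinP; apply: measurable_maxr => //; apply: measurable_funB => //.
exact: measurable_maxr.
Qed.

(** Tonelli and [integral_expR_pos] applied to [F_next]. The value at 0 is kept on the left so that
    no subtraction of extended reals occurs. *)
Let int_F_next n u : 0 <= u ->
  (\int[mu]_(v in `[0%R, u]) (lam * F n.+1 v)%:E + (F n.+1 0)%:E =
   (F n.+1 u)%:E + lam%:E * J n u)%E.
Proof.
move=> u0; pose f (z : Omega * R) := lam * expR (- lam * Num.max 0 (Y n 0 z.1 - z.2)).
have lam0 := ltW lam_gt0.
have mf : measurable_fun setT f.
  apply: measurable_funM => //; apply: measurableT_comp => //.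
  apply: measurable_funM => //; apply: measurable_maxr => //.
  by apply: measurable_funB => //; exact: measurableT_comp.
have f0 z : 0 <= f z by rewrite mulr_ge0 ?expR_ge0.
transitivity (\int[mu]_(v in `[0%R, u]) \int[P]_w (f (w, v))%:E +
    \int[P]_w (expR (- lam * Num.max 0 (Y n 0 w - 0)))%:E)%E.
  congr (_ + _)%E; last exact: F_next.
  apply: eq_integral => v; rewrite inE/= in_itv/= => /andP[v0 _].
  rewrite EFinM F_next// -ge0_integralZl ?lee_fin//.
rewrite -tonelli_on// F_next// -ge0_integralZl ?lee_fin//; last first.
  by move=> w _; rewrite lee_fin le_max lexx.
rewrite -!ge0_integralD//=; last 4 first.
- by move=> w _; rewrite mule_ge0 ?lee_fin ?le_max ?lexx.
- exact: measurable_funeM.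
- by move=> w _; apply: integral_ge0 => v _; rewrite lee_fin.
- rewrite (_ : (fun x => _) = (fun x => (expR (- lam * Num.max 0 (Y n 0 x - u)) -
      expR (- lam * Num.max 0 (Y n 0 x)) +
      lam * Num.max 0 (u - Num.max 0 (Y n 0 x)))%:E)); last first.
    by apply/funext => w; exact: (integral_expR_pos (Y n 0 w) lam_gt0 u0).
  have mexp0 : measurable_fun setT (fun w => expR (- lam * Num.max 0 (Y n 0 w))).
    apply: measurableT_comp => //; apply: measurable_funM => //.
    exact: measurable_maxr.
  apply/measurable_EFinP; apply: measurable_funD; last first.
    by apply: measurable_funM => //; exact/measurable_EFinP/mJ.
  by apply: measurable_funB => //; exact/measurable_EFinP/mexp.
apply: eq_integral => w _; rewrite [X in (X + _)%E](integral_expR_pos (Y n 0 w) lam_gt0 u0).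
rewrite subr0 -EFinM -!EFinD.
by congr EFin; rewrite addrAC subrK.
Qed.

(* With m the maximum of the shifted walk and x = U 0, integrate
   (u - m)^+ = min (x, (u - m)^+) + (u - m - x)^+. *)
Let int_F n u : 0 <= u ->
  (\int[mu]_(v in `[0%R, u]) (F n v)%:E =
   (renewal (ccdfr P (U 0%N)) (F n) u)%:E + J n u)%E.
Proof.
move=> u0.
have mU : measurable_fun setT (U 0%N) by exact: measurable_funPT.
transitivity (\int[P]_w (Num.max 0 (u - M n 1 w))%:E)%E.
  pose f (z : Omega * R) : R := (M n 1 z.1 <= z.2)%R%:R.
  transitivity (\int[mu]_(v in `[0%R, u]) \int[P]_w (f (w, v))%:E)%E.
    by apply: eq_integral => v _; rewrite -cdfr_M1 cdfr_integral.
  rewrite -tonelli_on//; last first.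
    by apply: measurable_fun_natr; apply: measurable_fun_ler => //; exact: measurableT_comp.
  by apply: eq_integral => w _; exact: (integral_le_itv (runmax_ge0 _ _ _ _) u0).
have -> : (renewal (ccdfr P (U 0%N)) (F n) u)%:E =
    (\int[P]_w (Num.min (Num.max 0 (U 0%N w)) (Num.max 0 (u - M n 1 w)))%:E)%E.
  rewrite renewalE; [|exact: unit_valued_ccdfr|exact: unit_valued_cdfr].
  pose f (z : Omega * R) : R := (z.2 < U 0%N z.1)%R%:R * (z.2 <= u - M n 1 z.1)%R%:R.
  transitivity (\int[mu]_(v in `[0%R, u]) \int[P]_w (f (w, v))%:E)%E.
    apply: eq_integral => v _; rewrite -cdfr_M1 EFinM ccdfrE// cdfrE//.
    (* Independence of the claim and the later maximum turns the product of their probabilities into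
       that of one joint event. *)
    have := @indUM n 0 `]v, +oo[%classic `]-oo, (u - v)]%classic
      (measurable_itv _) (measurable_itv _).
    rewrite (_ : _ @^-1` `]v, +oo[ = [set w | v < U 0%N w]); last first.
      by apply/seteqP; split => w /=; rewrite in_itv/= andbT.
    rewrite (_ : _ @^-1` `]-oo, (u - v)] = [set w | M n 1 w <= u - v]); last first.
      by apply/seteqP; split => w /=; rewrite in_itv.
    move=> <-; rewrite -[X in P X]setIT -integral_indic//; last first.
      by apply: measurableI; [exact: measurable_gt_set|exact: measurable_le_set].
    apply: eq_integral => w _; rewrite indicI /f /= !indicE !mem_setE /=.
    by rewrite lerBrDr -lerBrDl.
  rewrite -tonelli_on//.
  - apply: eq_integral => w _.
    have uM : u - M n 1 w <= u by rewrite gerBl; exact: runmax_ge0.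
    exact: (integral_lt_le_itv (U 0%N w) uM).
  - apply: measurable_funM; apply: measurable_fun_natr.
    + by apply: measurable_fun_ltr => //; exact: measurableT_comp.
    + apply: measurable_fun_ler => //; apply: measurable_funB => //.
      exact: measurableT_comp.
  - by move=> z; rewrite mulr_ge0.
have mmin : measurable_fun setT (fun w =>
    (Num.min (Num.max 0 (U 0%N w)) (Num.max 0 (u - M n 1 w)))%:E).
  apply/measurable_EFinP; apply: measurable_minr; apply: measurable_maxr => //.
  exact: measurable_funB.
rewrite /J -ge0_integralD//=.
- apply: ae_eq_integral => //.
  + apply/measurable_EFinP; apply: measurable_maxr => //; exact: measurable_funB.
  + exact: emeasurable_funD.
  + apply: filterS U_ge0 => w Uw _.
    have M0 : 0 <= M n 1 w by exact: runmax_ge0.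
    rewrite -EFinD; congr EFin.
    rewrite (max_r Uw) (_ : Num.max 0 (Y n 0 w) = U 0%N w + M n 1 w); last first.
      by rewrite max_r// addr_ge0.
    rewrite opprD addrCA [_ + (u - _)]addrC; set a := u - M n 1 w.
    have [a0|a0] := leP a 0.
      by rewrite min_r// max_l ?addr0// subr_le0 (le_trans a0).
    have [Ua|aU] := leP (U 0%N w) a; first by rewrite max_r ?subr_ge0// [RHS]addrC subrK.
    by rewrite max_l ?addr0// subr_le0 ltW.
- by move=> w _; rewrite lee_fin le_min !le_max !lexx.
- by move=> w _; rewrite lee_fin le_max lexx.
Qed.

Lemma cdfr_runmax_next n u : 0 <= u ->
  F n.+1 0 + lam * \int[mu]_(v in `[0, u]) F n.+1 v +
    lam * renewal (ccdfr P (U 0%N)) (F n) u =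
  F n.+1 u + lam * \int[mu]_(v in `[0, u]) F n v.
Proof.
move=> u0.
have iF m : mu.-integrable `[0, u] (EFin \o F m).
  have [mF F01] := unit_valued_cdfr P (mM m 0).
  apply: measurable_bounded_integrable => //.
  - by rewrite [X in (X < _)%E]lebesgue_measure_itvcc// ltry.
  - exact: measurable_funTS.
  - exists 1; split => // x x1 y _ /=; have /andP[F0 F1] := F01 y.
    by rewrite ger0_norm// (le_trans F1)// ltW.
have RF m : (\int[mu]_(v in `[0%R, u]) (F m v)%:E)%E =
    (\int[mu]_(v in `[0, u]) F m v)%:E.
  by rewrite /Rintegral fineK//; exact: integrable_fin_num (iF m).
have J0 : (0 <= J n u)%E.
  by apply: integral_ge0 => w _; rewrite lee_fin le_max lexx.
have := int_F n u0; have := int_F_next n u0.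
rewrite RF; under eq_integral do rewrite EFinM.
rewrite ge0_integralZl_EFin//=; last 3 first.
- move=> v _; rewrite lee_fin.
  by have /andP[] := (unit_valued_cdfr P (mM n.+1 0)).2 v.
- by have /integrableP[] := iF n.+1.
- exact: ltW.
(* The other terms of the identities are finite, which rules out an infinite [J]. *)
rewrite RF; case: (J n u) => [j| |] //=; rewrite -?EFinM -?EFinD.
move=> [E1] [E2]; rewrite E2 [F _ _ + _]addrC E1.
by rewrite -addrA -mulrDr [j + _]addrC.
Qed.

End ladder.

(** * The limit in the number of steps and the atom at 0 *)

Section renewal_limit.
Context (R : realType).
Notation mu := (@lebesgue_measure R).
Implicit Types (g F : R -> R) (u v y : R).

Lemma bounded_integrable_itv F u (c : R) : measurable_fun setT F ->
  (forall x, `|F x| <= c) -> mu.-integrable `[0, u] (EFin \o F).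
Proof.
move=> mF Fc; apply: measurable_bounded_integrable => //.
- rewrite [X in (X < _)%E]lebesgue_measure_itv/=; case: ifP => _; by rewrite ltry.
- exact: measurable_funTS.
- by exists c; split => [|x cx y _ /=]; [exact: num_real|exact: le_trans (Fc y) (ltW cx)].
Qed.

Lemma unit_valued_norm_le F : unit_valued F -> forall x, `|F x| <= 1.
Proof. by move=> [_ F01] x; have /andP[F0 F1] := F01 x; rewrite ger0_norm. Qed.

Lemma unit_valued_integrable F u : unit_valued F -> mu.-integrable `[0, u] (EFin \o F).
Proof.
by move=> Fu; apply: (bounded_integrable_itv _ Fu.1); exact: unit_valued_norm_le.
Qed.

Lemma unit_valued_convolvand g F u : unit_valued g -> unit_valued F ->
  unit_valued (fun y => g y * F (u - y)).
Proof.
move=> [mg g01] [mF F01]; split.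
  apply: measurable_funM => //; apply: measurableT_comp => //.
  exact: measurable_funB.
move=> y; have /andP[g0 g1] := g01 y; have /andP[F0 F1] := F01 (u - y).
by rewrite mulr_ge0//= -[leRHS]mulr1 ler_pM.
Qed.

Lemma cvg_Rintegral_itv (F_ : nat -> R -> R) F u :
  (forall n, unit_valued (F_ n)) -> unit_valued F ->
  (forall v, F_ n v @[n --> \oo] --> F v) ->
  \int[mu]_(v in `[0, u]) F_ n v @[n --> \oo] --> \int[mu]_(v in `[0, u]) F v.
Proof.
move=> F_u Fu F_F; apply: fine_cvg.
rewrite fineK; last exact: integrable_fin_num (unit_valued_integrable _ Fu).
have mE f : unit_valued f -> measurable_fun `[0, u] (fun v => (f v)%:E).
  by move=> [mf _]; apply/measurable_EFinP/measurable_funTS.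
have ig : mu.-integrable `[0, u] (EFin \o cst (1 : R)).
  by apply: (@bounded_integrable_itv _ _ 1) => // x; rewrite normr1.
have F_ae : {ae mu, forall v, `[0, u]%classic v -> (F_ n v)%:E @[n --> \oo] --> (F v)%:E}.
  by apply: aeW => v _; apply/cvg_EFin; [exact: nearW|exact: F_F].
have F_le : {ae mu, forall v n, `[0, u]%classic v ->
    (`|(F_ n v)%:E| <= (cst 1%R v)%:E)%E}.
  by apply: aeW => v n _; rewrite lee_fin; exact: unit_valued_norm_le.
by have [] := @dominated_convergence _ _ _ mu `[0, u]%classic (measurable_itv _)
  (fun n v => (F_ n v)%:E) (fun v => (F v)%:E) (EFin \o cst 1)
  (fun n => mE _ (F_u n)) (mE _ Fu) F_ae ig F_le.
Qed.

Context (lam rho : R) (g F : R -> R) (F_ : nat -> R -> R).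
Hypotheses (lam_gt0 : 0 < lam) (rho_lt1 : rho < 1).
Hypotheses (gu : unit_valued g) (Fu : unit_valued F) (Fneg : vanish_neg F).
Hypothesis F_u : forall n, unit_valued (F_ n).
Hypothesis F_nd : forall n, nondecreasing (F_ n).
Hypothesis F_ni : forall n v, F_ n.+1 v <= F_ n v.
Hypothesis F_y1 : forall n, F_ n m%:R @[m --> \oo] --> (1 : R).
Hypothesis F_F : forall v, F_ n v @[n --> \oo] --> F v.
Hypothesis g_rho : lam * \int[mu]_(y in `[0, n%:R]) g y @[n --> \oo] --> rho.
Hypothesis F_next : forall n u, 0 <= u ->
  F_ n.+1 0 + lam * \int[mu]_(v in `[0, u]) F_ n.+1 v + lam * renewal g (F_ n) u =
  F_ n.+1 u + lam * \int[mu]_(v in `[0, u]) F_ n v.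

Let lam0 : 0 <= lam. Proof. exact: ltW. Qed.

Let int_g_le n : lam * \int[mu]_(y in `[0, n%:R]) g y <= rho.
Proof.
apply: (cvgr_to_ge g_rho); near=> m.
have nm : (n <= m)%N by near: m; exact: nbhs_infty_ge.
rewrite ler_wpM2l// fine_le//.
- exact: integrable_fin_num (unit_valued_integrable _ gu).
- exact: integrable_fin_num (unit_valued_integrable _ gu).
- apply: ge0_subset_integral => //=.
  + by apply/measurable_EFinP/measurable_funTS; exact: gu.1.
  + by move=> y _; rewrite lee_fin; have /andP[] := gu.2 y.
  + by apply: subset_itvl; rewrite bnd_simp ler_nat.
Unshelve. all: by end_near. Qed.

(* Monotonicity in n makes the two remaining integrals comparable, so finiteness
   of the n-step maximum alone bounds the atom from below; no law of large
   numbers is needed. *)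
Let F_0_ge n : 1 - rho <= F_ n.+1 0.
Proof.
have : F_ n.+1 m%:R - rho @[m --> \oo] --> 1 - rho.
  by apply: cvgB; [exact: F_y1|exact: cvg_cst].
move=> /cvgr_to_le; apply; apply: nearW => m.
have m0 : (0 : R) <= m%:R by [].
have arith (a b c x y : R) : x + a + c = y + b -> a <= b -> c <= rho -> y - rho <= x.
  by move=> *; lra.
apply: arith (F_next n m0) _ _; first rewrite ler_wpM2l//.
  by apply: le_Rintegral => //; exact: unit_valued_integrable.
apply: le_trans (int_g_le m); rewrite ler_wpM2l//; apply: le_Rintegral => //.
- exact: (unit_valued_integrable _ (unit_valued_convolvand m%:R gu (F_u n))).
- exact: unit_valued_integrable.
- move=> y _; have /andP[g0 _] := gu.2 y; have /andP[_ F1] := (F_u n).2 (m%:R - y).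
  by rewrite -[leRHS]mulr1 ler_wpM2l.
Qed.

(** The integrals of [F_ n.+1] and of [F_ n] have the same limit by dominated convergence, so they
    cancel and only the unknown value at 0 remains. *)
Let F_lim u : 0 <= u -> F u = F 0 + lam * renewal g F u.
Proof.
move=> u0; pose I f := \int[mu]_(v in `[0, u]) f v.
have F_S v : F_ n.+1 v @[n --> \oo] --> F v.
  by have := @F_F v; rewrite -(cvg_shiftS (fun n => F_ n v : R)).
have cvgl : F_ n.+1 0 + lam * I (F_ n.+1) + lam * renewal g (F_ n) u @[n --> \oo]
    --> F 0 + lam * I F + lam * renewal g F u.
  apply: cvgD; [apply: cvgD; first exact: F_S|]; apply: cvgMr.
  - exact: cvg_Rintegral_itv.
  - apply: cvg_Rintegral_itv => [n||v]; [exact: unit_valued_convolvand..|].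
    by apply: cvgMr; exact: F_F.
have cvgr : F_ n.+1 u + lam * I (F_ n) @[n --> \oo] --> F u + lam * I F.
  by apply: cvgD; [exact: F_S|apply: cvgMr; exact: cvg_Rintegral_itv].
have : F 0 + lam * I F + lam * renewal g F u = F u + lam * I F.
  apply: (cvg_unique _ cvgl); first exact: Rhausdorff.
  rewrite (_ : (fun n => _) = fun n => F_ n.+1 u + lam * I (F_ n))//.
  by apply/funext => n; exact: F_next.
by rewrite addrAC => /addIr.
Qed.

(** By [F_lim], only the value of [F] at 0 is missing. The lower bound passes to the limit from
    [F_0_ge]; the upper bound comes from the behaviour of [F_lim] at infinity. *)
Lemma renewal_equation_limit u : F u = (1 - rho) * heaviside u + lam * renewal g F u.
Proof.
have [u0|u0] := leP 0 u; last first.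
  by rewrite Fneg// /heaviside leNgt u0 renewal_neg// !mulr0 addr0.
rewrite F_lim// /heaviside u0 mulr1; congr (_ + _); apply/eqP; rewrite eq_le.
apply/andP; split; last first.
  apply: (cvgr_to_ge (@F_F 0)); near=> n.
  have n0 : (0 < n)%N by near: n; exact: nbhs_infty_gt.
  by rewrite -(prednK n0).
have Fnd : nondecreasing F.
  move=> v w vw; apply: ler_cvg_to (@F_F v) (@F_F w) _; apply: nearW => n.
  exact: F_nd.
pose s : R^nat := fun n => F n%:R.
have s_ub : has_ubound (range s).
  by exists 1 => _ [n _ <-]; have /andP[] := Fu.2 n%:R.
have s_nd : nondecreasing_seq s by move=> n m nm; apply: Fnd; rewrite ler_nat.
have s_cvg := nondecreasing_cvgn s_nd s_ub.
(* The limit of [F] at infinity is not yet known to be 1, but l <= 1 is enough: F 0 <= l (1 - rho)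
   <= 1 - rho. *)
set l := sup (range s) in s_cvg.
have l1 : l <= 1.
  by apply: (cvgr_to_le s_cvg); apply: nearW => n; have /andP[] := Fu.2 n%:R.
have sl n : s n <= l by apply: ub_le_sup => //; exists n.
suff : F 0 <= l - l * rho.
  move=> /le_trans; apply; rewrite -[X in X - _]mulr1 -mulrBr.
  by rewrite -[leRHS]mul1r ler_wpM2r// subr_ge0 ltW.
have : l - s n * (lam * \int[mu]_(y in `[0, n%:R]) g y) @[n --> \oo] --> l - l * rho.
  by apply: cvgB; [exact: cvg_cst|exact: cvgM].
move=> /cvgr_to_ge; apply; apply: nearW => n.
have n20 : (0 : R) <= (n + n)%:R by [].
(* At u = 2 n, the integral is cut down to [0, n], where monotonicity gives F (2 n - y) >= F n. *)
have := F_lim n20; rewrite -/(s (n + n)%N) => sE.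
rewrite lerBrDr (le_trans _ (sl (n + n)%N))// sE lerD2l mulrCA ler_wpM2l//.
rewrite -RintegralZl//; last exact: unit_valued_integrable.
apply: (@le_trans _ _ (\int[mu]_(y in `[0, n%:R]) (g y * F ((n + n)%:R - y)))).
  apply: le_Rintegral => //.
  - apply: (@bounded_integrable_itv _ _ 1) => [|x].
      by apply: measurable_funM => //; exact: gu.1.
    have /andP[g0 g1] := gu.2 x; have /andP[F0 F1] := Fu.2 n%:R.
    by rewrite ger0_norm ?mulr_ge0// -[leRHS]mulr1 ler_pM.
  - exact: (unit_valued_integrable _ (unit_valued_convolvand _ gu Fu)).
  - move=> y /=; rewrite in_itv/= => /andP[y0 yn]; rewrite mulrC ler_wpM2l//.
      by have /andP[] := gu.2 y.
    by apply: Fnd; rewrite natrD -addrA lerDl subr_ge0.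
rewrite fine_le//.
- exact: integrable_fin_num (unit_valued_integrable _ (unit_valued_convolvand _ gu Fu)).
- exact: integrable_fin_num (unit_valued_integrable _ (unit_valued_convolvand _ gu Fu)).
- have hu := unit_valued_convolvand (n + n)%:R gu Fu.
  apply: ge0_subset_integral => //=.
  + by apply/measurable_EFinP/measurable_funTS; exact: hu.1.
  + by move=> y _; rewrite lee_fin; have /andP[] := hu.2 y.
  + by apply: subset_itvl; rewrite bnd_simp ler_nat leq_addr.
Unshelve. all: by end_near. Qed.

End renewal_limit.

(** * The Pollaczek-Khinchine equation *)

Section tails.
Context d (Omega : measurableType d) (R : realType) (P : probability Omega R).
Notation mu := (@lebesgue_measure R).

Lemma ae_eq_probability (A B : set Omega) : measurable A -> measurable B ->
  {ae P, forall w, A w <-> B w} -> P A = P B.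
Proof.
move=> mA mB AB; rewrite -[A]setIT -[B]setIT -!integral_indic//.
apply: ae_eq_integral => //; [exact/measurable_EFinP..|].
apply: filterS AB => w AB _; rewrite !indicE (_ : (w \in A) = (w \in B))//.
by apply/idP/idP; rewrite !inE => /AB.
Qed.

Lemma cvg_cdfr_nat (X : Omega -> R) : measurable_fun setT X ->
  cdfr P X n%:R @[n --> \oo] --> (1 : R).
Proof.
move=> mX; apply: fine_cvg; rewrite -(probability_setT P).
have -> : [set: Omega] = \bigcup_n [set w | X w <= n%:R].
  apply/esym; rewrite -subTset => w _; exists (Num.truncn (X w)).+1 => //=.
  exact/ltW/truncnS_gt.
apply: nondecreasing_cvg_mu.
- by move=> n; exact: measurable_le_set.
- by apply: bigcup_measurable => n _; exact: measurable_le_set.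
- move=> n m nm; apply/subsetPset => w /= /le_trans; apply.
  by rewrite ler_nat.
Qed.

Lemma cvg_integral_survival (X : {RV P >-> R}) :
  {ae P, forall w, 0 <= X w} -> ('E_P[X] < +oo)%E ->
  \int[mu]_(y in `[0, n%:R]) ccdfr P X y @[n --> \oo] --> fine 'E_P[X].
Proof.
move=> X0 EX; have mX : measurable_fun setT X by exact: measurable_funPT.
have mXp : measurable_fun setT (fun w => Num.max 0 (X w)) by exact: measurable_maxr.
(* The tail formula for the expectation requires nonnegativity at every point, not just almost
   surely; the positive part has it and the same expectation. *)
pose Xp : {RV P >-> R} := HB.pack (fun w => Num.max 0 (X w))
  (isMeasurableFun.Build _ _ _ _ _ mXp).
have EXp : ('E_P[X] = 'E_P[Xp])%E.
  rewrite !expectation_def; apply: ae_eq_integral => //.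
  - exact/measurable_EFinP.
  - exact/measurable_EFinP.
  - by apply: filterS X0 => w Xw _; rewrite /= max_r.
have [mg g01] := unit_valued_ccdfr P mX.
have EXi : ('E_P[X] = \int[mu]_(y in \bigcup_n `[0%R, n%:R]%classic) (ccdfr P X y)%:E)%E.
  rewrite EXp ge0_expectation_ccdf; last by move=> w; rewrite /= le_max lexx.
  have -> : \bigcup_n `[0, n%:R]%classic = `[0, +oo[%classic :> set R.
    apply/seteqP; split => [y [n _]|y] /=; rewrite !in_itv/= ?andbT.
      by case/andP.
    move=> y0; exists (Num.truncn y).+1 => //=.
    by rewrite in_itv/= y0 ltW// truncnS_gt.
  apply: eq_integral => y; rewrite inE/= in_itv/= andbT => y0.
  rewrite ccdfrE// /ccdf /distribution /pushforward; congr (P _).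
  by apply/seteqP; split => w /=; rewrite in_itv/= andbT lt_max (ltNge y 0) y0.
have EX0 : ('E_P[X])%E \is a fin_num.
  rewrite ge0_fin_numE// EXi; apply: integral_ge0 => y _; rewrite lee_fin.
  by have /andP[] := g01 y.
apply: fine_cvg; rewrite fineK// EXi.
apply: ge0_nondecreasing_set_cvg_integral => //.
- by move=> n m nm; apply/subsetPset; apply: subset_itvl; rewrite bnd_simp ler_nat.
- by move=> n; apply/measurable_EFinP/measurable_funTS.
- by move=> n y _; rewrite lee_fin; have /andP[] := g01 y.
Qed.

End tails.

(** * From the loss in continuous time to the embedded random walk *)

Section maximal_loss.
Context (Omega : Type) (R : realType) (N : R -> Omega -> nat) (T U : nat -> Omega -> R).
Hypothesis NT : counts T N.

(* The supremum over the times t with N t = n is attained at the positive part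
   of the n-th epoch, provided the interval of such t is nonempty; this holds on
   every path, in particular where interarrival times are negative. *)
Lemma max_loss_gtP (u : R) w : (u%:E < max_loss N U w)%E <->
  exists n, let tau := Num.max 0 (\sum_(i < n) T i w) in
    tau < \sum_(i < n.+1) T i w /\ u < \sum_(i < n) U i w - tau.
Proof.
split.
  move=> /ereal_sup_gt[_ [t /= t0 <-]]; rewrite lte_fin => ut.
  exists (N t w) => /=; set tau := Num.max _ _.
  have tau_t : tau <= t by rewrite ge_max t0 -(NT w _ t0) leqnn.
  split; last by rewrite (lt_le_trans ut)// lerB.
  by apply: (le_lt_trans tau_t); rewrite ltNge -(NT w _ t0) ltnn.
move=> [n /= [tau_lt u_lt]].
set tau := Num.max 0 (\sum_(i < n) T i w) in tau_lt u_lt.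
have tau0 : 0 <= tau by rewrite le_max lexx.
have Nn : N tau w = n.
  apply/eqP; rewrite eqn_leq (NT w n tau0) le_max lexx orbT andbT.
  by rewrite leqNgt (NT w n.+1 tau0) -ltNge.
apply: (@lt_le_trans _ _ (\sum_(i < n) U i w - tau)%:E); first by rewrite lte_fin.
by apply: ereal_sup_ubound; exists tau => //; rewrite Nn.
Qed.

(** The supremum over uncountably many times becomes a countable union, which yields measurability
    of the ruin event. *)
Lemma max_loss_gt_set u : [set w | (u%:E < max_loss N U w)%E] =
  \bigcup_n [set w | Num.max 0 (\sum_(i < n) T i w) < \sum_(i < n.+1) T i w /\
                     u < \sum_(i < n) U i w - Num.max 0 (\sum_(i < n) T i w)].
Proof.
by apply/seteqP; split => w /=; [move=> /max_loss_gtP[n ?]; exists n|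
                                 move=> [n _ ?]; apply/max_loss_gtP; exists n].
Qed.

(** With positive interarrival times every value of [N] is taken, first at the corresponding epoch,
    where the loss is a partial sum of the walk. *)
Lemma max_loss_gt_runmax (u : R) w : (forall i, 0 < T i w) ->
  (u%:E < max_loss N U w)%E <->
  ~ (forall n, runmax (fun i w => U i w - T i w) n 0 w <= u).
Proof.
move=> T0.
have tau0 n : 0 <= \sum_(i < n) T i w by apply: sumr_ge0 => i _; exact: ltW.
split.
  move=> /max_loss_gtP[n /= [_ un]]; rewrite (max_r (tau0 n)) -sumrB in un.
  move=> /(_ n) /runmax_leP /(_ n (leqnn _)).
  by rewrite leNgt => /negP; apply; under eq_bigr do rewrite add0n.
move=> /existsNP[n /negP]; rewrite -ltNge => un.
apply: contrapT => Hu; move: un; apply/negP; rewrite -leNgt.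
apply/runmax_leP => j _; rewrite leNgt; apply/negP => uj; apply: Hu.
apply/max_loss_gtP; exists j => /=; rewrite (max_r (tau0 j)); split.
  by rewrite big_ord_recr/= ltrDl.
by rewrite -sumrB; under [ltRHS]eq_bigr do rewrite -[nat_of_ord _]add0n.
Qed.

End maximal_loss.

Lemma measurable_max_loss_gt d (Omega : measurableType d) (R : realType)
    (N : R -> Omega -> nat) (T U : nat -> Omega -> R) (u : R) :
  counts T N ->
  (forall i, measurable_fun setT (T i)) -> (forall i, measurable_fun setT (U i)) ->
  measurable [set w | (u%:E < max_loss N U w)%E].
Proof.
move=> NT mT mU; rewrite (max_loss_gt_set U NT); apply: bigcupT_measurable => n.
have mS (V : nat -> Omega -> R) m : (forall i, measurable_fun setT (V i)) ->
    measurable_fun setT (fun w => \sum_(i < m) V i w).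
  by move=> mV; apply: measurable_sum => i; exact: mV.
have mtau : measurable_fun setT (fun w => Num.max 0 (\sum_(i < n) T i w)).
  by apply: measurable_maxr => //; exact: mS.
have m1 := measurable_gt_set 0 (measurable_funB (mS T n.+1 mT) mtau).
have m2 := measurable_gt_set u (measurable_funB (mS U n mU) mtau).
have := measurableI _ _ m1 m2; congr measurable.
by apply/seteqP; split => w /=; rewrite subr_gt0.
Qed.

Lemma measurable_runmax d (Omega : measurableType d) (R : realType)
    (X : nat -> Omega -> R) n k :
  (forall i, measurable_fun setT (X i)) -> measurable_fun setT (runmax X n k).
Proof.
move=> mX; elim: n k => [|n IH] k; first exact: measurable_cst.
by apply: measurable_maxr => //; apply: measurable_funD.
Qed.

Section pollaczek_khinchine.
Context d (Omega : measurableType d) (R : realType) (P : probability Omega R).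
Notation mu := (@lebesgue_measure R).
Context (lam eps : R) (B C : {RV P >-> R}) (N : R -> Omega -> nat)
  (U : nat -> {RV P >-> R}).
Hypotheses (lam_gt0 : 0 < lam) (eps_ge0 : 0 <= eps) (eps_le1 : eps <= 1).
Hypotheses (B_ge0 : {ae P, forall w, 0 <= B w}) (C_ge0 : {ae P, forall w, 0 <= C w}).
Hypotheses (EB_fin : ('E_P[B] < +oo)%E) (EC_fin : ('E_P[C] < +oo)%E).
Hypothesis model : cramer_lundberg lam eps B C N U.

Definition mixture_survival y := (1 - eps) * ccdfr P B y + eps * ccdfr P C y.

Definition claim_load := (1 - eps) * (lam * fine 'E_P[B]) + eps * (lam * fine 'E_P[C]).

Hypothesis load_lt1 : claim_load < 1.

Let mB : measurable_fun setT B. Proof. exact: measurable_funPT. Qed.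
Let mC : measurable_fun setT C. Proof. exact: measurable_funPT. Qed.
Let mU i : measurable_fun setT (U i). Proof. exact: measurable_funPT. Qed.

Let lawU i (A : set R) : measurable A ->
  P (U i @^-1` A) = ((1 - eps)%:E * P (B @^-1` A) + eps%:E * P (C @^-1` A))%E.
Proof. by move=> mA; case: model => T [_ _ _ /(_ i A mA)]. Qed.

Lemma unit_valued_mixture_survival : unit_valued mixture_survival.
Proof.
have [mb b01] := unit_valued_ccdfr P mB; have [mc c01] := unit_valued_ccdfr P mC.
split; first by apply: measurable_funD; apply: measurable_funM.
move=> y; rewrite /mixture_survival.
have /andP[b0 b1] := b01 y; have /andP[c0 c1] := c01 y.
rewrite addr_ge0 ?mulr_ge0 ?subr_ge0//= -[leRHS](subrK eps).
by rewrite lerD// -[leRHS]mulr1 ler_wpM2l// subr_ge0.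
Qed.

Let survivalU : ccdfr P (U 0%N) = mixture_survival.
Proof.
apply/funext => y; apply: EFin_inj; rewrite ccdfrE// EFinD !EFinM !ccdfrE//.
have E (V : Omega -> R) : [set w | y < V w] = V @^-1` `]y, +oo[%classic.
  by apply/seteqP; split => w /=; rewrite in_itv/= andbT.
by rewrite !E lawU.
Qed.

Let U_ge0 : {ae P, forall w, 0 <= U 0%N w}.
Proof.
have E (V : Omega -> R) : ~` [set w | 0 <= V w] = V @^-1` `]-oo, 0[%classic.
  by apply/seteqP; split => w /=; rewrite in_itv/= ltNge => /negP.
have V0 (V : {RV P >-> R}) : {ae P, forall w, 0 <= V w} -> P (V @^-1` `]-oo, 0[%classic) = 0%E.
  move=> V0; apply: measure_negligible; first exact: measurable_funPTI.
  by rewrite -E.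
exists (U 0%N @^-1` `]-oo, 0[%classic); split.
- exact: measurable_funPTI.
- by rewrite lawU// !V0// !mule0 adde0.
- by rewrite E.
Qed.

Let survival_load :
  lam * \int[mu]_(y in `[0, n%:R]) mixture_survival y @[n --> \oo] --> claim_load.
Proof.
have [bu cu] := (unit_valued_ccdfr P mB, unit_valued_ccdfr P mC).
rewrite (_ : (fun n => _) = fun n : nat =>
    (1 - eps) * (lam * \int[mu]_(y in `[0, n%:R]) ccdfr P B y) +
    eps * (lam * \int[mu]_(y in `[0, n%:R]) ccdfr P C y)).
  by apply: cvgD; do 2 apply: cvgMr; exact: cvg_integral_survival.
have iZ c f n : unit_valued f -> mu.-integrable `[0, n%:R] (EFin \o (fun y => c * f y)).
  move=> fu; apply: (@bounded_integrable_itv _ _ _ `|c|) => [|x].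
    by apply: measurable_funM => //; exact: fu.1.
  by rewrite normrM ler_piMr// unit_valued_norm_le.
apply/funext => n; rewrite /mixture_survival RintegralD//; [|exact: iZ..].
rewrite !RintegralZl//; [|exact: unit_valued_integrable..].
by rewrite mulrDr !(mulrCA lam).
Qed.

Let phi u := 1 - ruin_prob P N (fun j => U j : Omega -> R) u.

(** The third clause says that [fine] loses nothing in [ruin_prob], so that laws of the
    extended-real maximum can be compared with it. *)
Lemma pollaczek_khinchine :
  [/\ unit_valued phi, vanish_neg phi,
      forall u, P [set w | (u%:E < max_loss N (fun j => U j : Omega -> R) w)%E] =
                (ruin_prob P N (fun j => U j : Omega -> R) u)%:E &
      forall u, phi u = (1 - claim_load) * heaviside u +
                        lam * renewal mixture_survival phi u].
Proof.
case: (model) => T [indTU lawT NT _].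
have mT i : measurable_fun setT (T i) by exact: measurable_funPT.
pose M n := runmax (fun i w => U i w - T i w) n 0.
have mM n : measurable_fun setT (M n).
  by apply: measurable_runmax => i; exact: measurable_funB.
pose A u := \bigcap_n [set w | M n w <= u].
have mA u : measurable (A u).
  by apply: bigcapT_measurable => n; exact: measurable_le_set.
(* The walk and the loss process are related only on paths with positive interarrival times; the
   exponential law gives no mass to the others. *)
have T_gt0 : {ae P, forall w, forall i, 0 < T i w}.
  apply/ae_foralln => i.
  exists (T i @^-1` `]-oo, 0]%classic); split; first exact: measurable_funPTI.
    by have := lawT i _ (measurable_itv `]-oo, 0]); rewrite exponential_prob_le0.
  by move=> w /= /negP; rewrite in_itv/= leNgt.
have mML u := measurable_max_loss_gt u NT mT mU.
have ruinA u : P [set w | (u%:E < max_loss N (fun j => U j : Omega -> R) w)%E] = P (~` A u).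
  apply: ae_eq_probability => //; first exact: measurableC.
  apply: filterS T_gt0 => w T0; rewrite /= (max_loss_gt_runmax _ NT _ T0).
  by split=> [nM AM|nA AM]; [apply: nM => n; exact: AM|apply: nA => n _; exact: AM].
have phiA u : phi u = fine (P (A u)).
  rewrite /phi /ruin_prob ruinA probability_setC// fineB ?fin_num_measure//.
  by rewrite opprB addrC subrK.
(* The events that the n-step maximum is at most [u] decrease to [A u]: continuity from above. *)
have cvg_phi u : cdfr P (M n) u @[n --> \oo] --> phi u.
  rewrite phiA; apply: fine_cvg; rewrite fineK ?fin_num_measure//.
  apply: nonincreasing_cvg_mu => //.
  - by rewrite ltey_eq fin_num_measure//; exact: measurable_le_set.
  - by move=> n; exact: measurable_le_set.
  - exact: mA.
  - move=> n m nm; apply/subsetPset => w /=; apply: le_trans.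
    exact: runmax_nondecreasing.
have phi01 u : 0 <= phi u <= 1.
  rewrite phiA fine_ge0// -lee_fin fineK ?fin_num_measure//.
  exact: probability_le1.
have phi_nd : nondecreasing phi.
  move=> u v uv; rewrite !phiA fine_le ?fin_num_measure//.
  by apply: le_measure; rewrite ?inE// => w Aw n I; exact: le_trans (Aw n I) uv.
have phiu : unit_valued phi by split => //; exact: nondecreasing_measurable.
have phin : vanish_neg phi.
  move=> v v0; rewrite phiA (_ : A v = set0) ?measure0//.
  rewrite -subset0 => w /(_ 0%N I) /=.
  by rewrite leNgt v0.
split=> // [u|].
  by rewrite fineK// fin_num_measure.
have lawU0 i (D : set R) : measurable D -> P (U i @^-1` D) = P (U 0%N @^-1` D).
  by move=> mD; rewrite !lawU.
apply: (@renewal_equation_limit _ lam claim_load _ _ (fun n => cdfr P (M n))) => //.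
- exact: unit_valued_mixture_survival.
- by move=> n; exact: unit_valued_cdfr.
- by move=> n; exact: cdfr_nondecreasing.
- move=> n v; rewrite -lee_fin !cdfrE//.
  apply: le_measure; rewrite ?inE; [exact: measurable_le_set..|].
  by move=> w /=; apply: le_trans; exact: runmax_nondecreasing.
- by move=> n; exact: cvg_cdfr_nat.
- move=> n u u0; rewrite -survivalU.
  exact: (cdfr_runmax_next lam_gt0 indTU lawT lawU0 U_ge0).
Qed.

End pollaczek_khinchine.

(** * Sums of independent copies *)

Section stationary_excess_theory.
Context d (Omega : measurableType d) (R : realType) (P : probability Omega R).
Notation mu := (@lebesgue_measure R).

(** The event X < 0 is the countable union of the null events X <= - 1 / (n + 1). *)
Lemma vanish_neg_ae_ge0 (X : {RV P >-> R}) : vanish_neg (cdfr P X) ->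
  {ae P, forall w, 0 <= X w}.
Proof.
move=> X0; have mX : measurable_fun setT X by exact: measurable_funPT.
have : {ae P, forall w, forall n, - n.+1%:R^-1 < X w}.
  apply/ae_foralln => n; exists [set w | X w <= - n.+1%:R^-1]; split.
  - exact: measurable_le_set.
  - transitivity (cdfr P X (- n.+1%:R^-1))%:E; first exact/esym/cdfrE.
    by rewrite X0// oppr_lt0 invr_gt0.
  - by move=> w /= /negP; rewrite -leNgt.
apply: filterS => w Xw; rewrite leNgt; apply/negP => Xw0.
have [n] := ltr_add_invr Xw0.
by rewrite -ltrBrDl sub0r ltNge ltW// ltrNl.
Qed.

Lemma cdf_cdfr (X : {RV P >-> R}) u : cdf X u = (cdfr P X u)%:E.
Proof.
by rewrite cdfrE// /cdf /distribution /pushforward; congr (P _).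
Qed.

Lemma stationary_excess_cdfr (X Xe : {RV P >-> R}) :
  0 <= fine 'E_P[X] -> stationary_excess X Xe ->
  forall v, cdfr P Xe v = (fine 'E_P[X])^-1 * renewal (ccdfr P X) heaviside v.
Proof.
move=> EX0 XXe.
have mX : measurable_fun setT X by exact: measurable_funPT.
have mXe : measurable_fun setT Xe by exact: measurable_funPT.
have pos v : 0 <= v ->
    cdfr P Xe v = (fine 'E_P[X])^-1 * renewal (ccdfr P X) heaviside v.
  move=> v0; apply: EFin_inj; rewrite -cdf_cdfr XXe// EFinM.
  rewrite renewalE; [|exact: unit_valued_ccdfr|exact: unit_valued_heaviside].
  congr (_ * _)%E; apply: eq_integral => y; rewrite inE/= in_itv/= => /andP[_ yv].
  by rewrite cdf_cdfr ccdfr_1_cdfr// /heaviside subr_ge0 yv mulr1 EFinB.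
move=> v; have [v0|v0] := leP 0 v; first exact: pos.
(* [stationary_excess] prescribes the distribution function only on the half-line; its value 0 at 0
   and monotonicity force it to vanish on negative arguments. *)
have Xe0 : cdfr P Xe 0 = 0.
  by rewrite pos// /renewal set_itv1 Rintegral_set1 mulr0.
rewrite renewal_neg// mulr0; apply/eqP; rewrite eq_le.
have /andP[-> _] := (unit_valued_cdfr P mXe).2 v; rewrite andbT.
by rewrite -[leRHS]Xe0; apply: cdfr_nondecreasing => //; exact: ltW.
Qed.

Lemma stationary_excess_ge0 (X Xe : {RV P >-> R}) :
  0 <= fine 'E_P[X] -> stationary_excess X Xe -> {ae P, forall w, 0 <= Xe w}.
Proof.
move=> EX0 XXe; apply: vanish_neg_ae_ge0 => v v0.
by rewrite (stationary_excess_cdfr EX0 XXe) renewal_neg// mulr0.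
Qed.

End stationary_excess_theory.

Section sums_of_copies.
Context d (Omega : measurableType d) (R : realType) (P : probability Omega R).
Context (M0c Ce Be : nat -> {RV P >-> R}).
Hypothesis copies_indep : independent_RVs (join2 (join2 M0c Ce) Be).
Hypotheses (M0c_ge0 : forall i, {ae P, forall w, 0 <= M0c i w})
  (Ce_ge0 : forall i, {ae P, forall w, 0 <= Ce i w})
  (Be_ge0 : forall i, {ae P, forall w, 0 <= Be i w}).

(** Here [n] counts the copies of M_0, whereas [sum_tail] with index s has s + 1 of them. The empty
    sum is thus available, and its distribution function is the unit [heaviside]. *)
Definition copies_sum n m r (w : Omega) :=
  \sum_(i < n) M0c i w + \sum_(i < m) Ce i w + \sum_(i < r) Be i w.

Definition copies_cdf n m r := cdfr P (copies_sum n m r).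

Lemma measurable_copies_sum n m r : measurable_fun setT (copies_sum n m r).
Proof.
by apply: measurable_funD; [apply: measurable_funD|]; apply: measurable_sum => i;
  exact: measurable_funPT.
Qed.

Lemma copies_sum_ge0 n m r : {ae P, forall w, 0 <= copies_sum n m r w}.
Proof.
have H0 : {ae P, forall w, forall i, 0 <= M0c i w} by apply/ae_foralln.
have H1 : {ae P, forall w, forall i, 0 <= Ce i w} by apply/ae_foralln.
have H2 : {ae P, forall w, forall i, 0 <= Be i w} by apply/ae_foralln.
apply: filterS3 H0 H1 H2 => w w0 w1 w2.
by rewrite !addr_ge0//; apply: sumr_ge0.
Qed.

Lemma copies_sumSM n m r : copies_sum n.+1 m r = copies_sum n m r \+ M0c n.
Proof.
apply/funext => w; rewrite /copies_sum /= big_ord_recr /=.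
by rewrite -!addrA; congr (_ + _); rewrite addrC addrA.
Qed.

Lemma copies_sumSC n m r : copies_sum n m.+1 r = copies_sum n m r \+ Ce m.
Proof.
apply/funext => w; rewrite /copies_sum /= big_ord_recr /=.
by rewrite -!addrA; do 2 congr (_ + _); rewrite addrC.
Qed.

Lemma copies_sumSB n m r : copies_sum n m r.+1 = copies_sum n m r \+ Be r.
Proof. by apply/funext => w; rewrite /copies_sum /= big_ord_recr /= addrA. Qed.

(** The side condition says that copy [k] has not entered the sum, which is therefore measurable for
    the sigma-algebra of all other copies. *)
Let indep_copy (k : nat + nat + nat) n m r :
  match k with
  | inl (inl i) => (n <= i)%N | inl (inr i) => (m <= i)%N | inr i => (r <= i)%N
  end ->
  indep2 P (join2 (join2 M0c Ce) Be k) (copies_sum n m r).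
Proof.
move=> kP; apply: (@indep_sigma_rectangles _ _ _ _ _ (join2 (join2 M0c Ce) Be) [set~ k]) => //.
  by move=> /(_ erefl).
have mK (j : nat + nat + nat) : j <> k ->
    measurable_fun (setT : set (g_sigma_algebraType
      (rectangles (join2 (join2 M0c Ce) Be) [set~ k]))) (join2 (join2 M0c Ce) Be j).
  move=> jk; exact: (@measurable_fun_sigma_rectangles _ _ _ _ _
    (join2 (join2 M0c Ce) Be) [set~ k] j jk).
apply: measurable_funD; [apply: measurable_funD|]; apply: measurable_sum => i.
- have := mK (inl (inl (i : nat))); apply.
  by move=> ki; move: kP; rewrite -ki leqNgt ltn_ord.
- have := mK (inl (inr (i : nat))); apply.
  by move=> ki; move: kP; rewrite -ki leqNgt ltn_ord.
- have := mK (inr (i : nat)); apply.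
  by move=> ki; move: kP; rewrite -ki leqNgt ltn_ord.
Qed.

Lemma unit_valued_copies_cdf n m r : unit_valued (copies_cdf n m r).
Proof. exact/unit_valued_cdfr/measurable_copies_sum. Qed.

Lemma vanish_neg_copies_cdf n m r : vanish_neg (copies_cdf n m r).
Proof. by apply: vanish_neg_cdfr; [exact: measurable_copies_sum|exact: copies_sum_ge0]. Qed.

Lemma copies_cdf0 : copies_cdf 0 0 0 = heaviside.
Proof.
apply/funext => u; rewrite /copies_cdf /cdfr /copies_sum /heaviside.
under eq_set do rewrite !big_ord0 !addr0.
case: (leP 0 u) => u0.
  by rewrite (_ : [set _ | _] = setT) ?probability_setT//; apply/seteqP; split.
by rewrite (_ : [set _ | _] = set0) ?measure0//; apply/seteqP; split.
Qed.

Lemma sum_tail_cdf s m r u :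
  sum_tail P (fun i => M0c i : Omega -> R) (fun i => Ce i : Omega -> R)
    (fun i => Be i : Omega -> R) s m r u = 1 - copies_cdf s.+1 m r u.
Proof. exact: (ccdfr_1_cdfr _ _ (measurable_copies_sum s.+1 m r)). Qed.

Lemma copies_cdf_M0 n m r (a l : R) g u : unit_valued g -> 0 <= a -> 0 <= l ->
  (forall v, cdfr P (M0c n) v = a * heaviside v + l * renewal g (cdfr P (M0c n)) v) ->
  copies_cdf n.+1 m r u = a * copies_cdf n m r u + l * renewal g (copies_cdf n.+1 m r) u.
Proof.
move=> gu a0 l0 ME; rewrite /copies_cdf copies_sumSM.
apply: cdfr_add_renewal => //.
- exact: measurable_copies_sum.
- exact: (@indep_copy (inl (inl n))).
- exact: copies_sum_ge0.
Qed.

Lemma copies_cdf_Ce n m r (c : R) g u : unit_valued g -> 0 <= c ->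
  (forall v, cdfr P (Ce m) v = c * renewal g heaviside v) ->
  copies_cdf n m.+1 r u = c * renewal g (copies_cdf n m r) u.
Proof.
move=> gu c0 CE; rewrite /copies_cdf copies_sumSC.
apply: cdfr_add_density => //.
- exact: measurable_copies_sum.
- exact: (@indep_copy (inl (inr m))).
- exact: copies_sum_ge0.
Qed.

Lemma copies_cdf_Be n m r (c : R) g u : unit_valued g -> 0 <= c ->
  (forall v, cdfr P (Be r) v = c * renewal g heaviside v) ->
  copies_cdf n m r.+1 u = c * renewal g (copies_cdf n m r) u.
Proof.
move=> gu c0 BE; rewrite /copies_cdf copies_sumSB.
apply: cdfr_add_density => //.
- exact: measurable_copies_sum.
- exact: (@indep_copy (inr r)).
- exact: copies_sum_ge0.
Qed.

End sums_of_copies.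

(** * The expansion *)

Section renewal_linearity.
Context (R : realType).
Notation mu := (@lebesgue_measure R).
Implicit Types (g F : R -> R) (u v y : R).

(** Signed combinations of distribution functions leave [0, 1]; this class is closed under them, and
    [renewal g] is linear on it. *)
Definition bounded_measurable F := measurable_fun setT F /\ exists c, forall x, `|F x| <= c.

Lemma unit_valued_bounded F : unit_valued F -> bounded_measurable F.
Proof. by move=> Fu; split; [exact: Fu.1|exists 1; exact: unit_valued_norm_le]. Qed.

Lemma bounded_measurableZ c F : bounded_measurable F ->
  bounded_measurable (fun v => c * F v).
Proof.
move=> [mF [k Fk]]; split; first exact: measurable_funM.
by exists (`|c| * k) => x; rewrite normrM ler_wpM2l.
Qed.

Lemma bounded_measurableD F F' : bounded_measurable F -> bounded_measurable F' ->
  bounded_measurable (fun v => F v + F' v).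
Proof.
move=> [mF [k Fk]] [mF' [k' Fk']]; split; first exact: measurable_funD.
by exists (k + k') => x; rewrite (le_trans (ler_normD _ _))// lerD.
Qed.

Lemma bounded_measurable_sum n (F : nat -> R -> R) :
  (forall k, bounded_measurable (F k)) ->
  bounded_measurable (fun v => \sum_(k < n) F k v).
Proof.
move=> Fb; elim: n => [|n IH].
  under eq_fun do rewrite big_ord0.
  by split; [exact: measurable_cst|exists 0 => x; rewrite normr0].
by under eq_fun do rewrite big_ord_recr; exact: bounded_measurableD.
Qed.

Lemma integrable_convolvand g F u : unit_valued g -> bounded_measurable F ->
  mu.-integrable `[0, u] (EFin \o (fun y => g y * F (u - y))).
Proof.
move=> [mg g01] [mF [k Fk]]; apply: (@bounded_integrable_itv _ _ _ k) => [|y].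
  apply: measurable_funM => //; apply: measurableT_comp => //.
  exact: measurable_funB.
have /andP[g0 g1] := g01 y; rewrite normrM ger0_norm// (le_trans _ (Fk (u - y)))//.
by rewrite ler_piMl.
Qed.

Lemma renewalZ g c F u : unit_valued g -> bounded_measurable F ->
  renewal g (fun v => c * F v) u = c * renewal g F u.
Proof.
move=> gu Fb; rewrite /renewal -RintegralZl//; last exact: integrable_convolvand.
by apply: eq_Rintegral => y _; rewrite mulrCA.
Qed.

Lemma renewalD g F F' u : unit_valued g -> bounded_measurable F ->
  bounded_measurable F' ->
  renewal g (fun v => F v + F' v) u = renewal g F u + renewal g F' u.
Proof.
move=> gu Fb Fb'; rewrite /renewal -RintegralD//; [|exact: integrable_convolvand..].
by apply: eq_Rintegral => y _; rewrite mulrDr.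
Qed.

Lemma renewal_sum g n (F : nat -> R -> R) u : unit_valued g ->
  (forall k, bounded_measurable (F k)) ->
  renewal g (fun v => \sum_(k < n) F k v) u = \sum_(k < n) renewal g (F k) u.
Proof.
move=> gu Fb; elim: n => [|n IH].
  rewrite big_ord0 /renewal (_ : (fun _ => _) = fun=> 0) ?Rintegral_cst ?mul0r//.
  by apply/funext => y; rewrite big_ord0 mulr0.
rewrite big_ord_recr /= -IH -renewalD//; last exact: bounded_measurable_sum.
by congr renewal; apply/funext => v; rewrite big_ord_recr.
Qed.

Lemma renewal_mixture a b g h F u : unit_valued g -> unit_valued h ->
  bounded_measurable F ->
  renewal (fun y => a * g y + b * h y) F u = a * renewal g F u + b * renewal h F u.
Proof.
move=> gu hu Fb; rewrite -!renewalZ// /renewal.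
have ig := integrable_convolvand u gu (bounded_measurableZ a Fb).
have ih := integrable_convolvand u hu (bounded_measurableZ b Fb).
rewrite -(RintegralD _ ig ih)//.
by apply: eq_Rintegral => y _; rewrite mulrDl [g y * _]mulrCA [h y * _]mulrCA !mulrA.
Qed.

(** Since 0 <= g <= 1, the integrand is at most K exp (s (u - y)), whose integral over [0, u] is K
    (exp (s u) - 1) / s. *)
Lemma renewal_exp_bound g F s K : 0 < s -> 0 <= K -> unit_valued g ->
  bounded_measurable F -> (forall v, `|F v| <= K * expR (s * v)) ->
  forall u, `|renewal g F u| <= K / s * expR (s * u).
Proof.
move=> s0 K0 gu Fb FK u.
have [u0|u0] := leP 0 u; last first.
  by rewrite renewal_neg// normr0 mulr_ge0 ?expR_ge0// divr_ge0// ltW.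
pose E y := s * expR (s * (u - y)).
have E0 y : 0 <= E y by rewrite mulr_ge0 ?expR_ge0// ltW.
have mE : measurable_fun setT E.
  have m1 : measurable_fun setT (fun y => u - y) by exact: measurable_funB.
  have m2 : measurable_fun setT (fun y => s * (u - y)) by exact: measurable_funM.
  by apply: measurable_funM => //; exact: measurableT_comp.
have intE : (\int[mu]_(y in `[0%R, u]) (E y)%:E = (expR (s * u) - 1)%:E)%E.
  (* With rate - s the formula concerns the negated integrand, hence the sign changes below. *)
  have := integral_expR_itv (- s) u u0.
  rewrite subrr mulr0 expR0 mulrNN => intN.
  have -> : (\int[mu]_(y in `[0%R, u]) (E y)%:E =
      - \int[mu]_(y in `[0%R, u]) (- s * expR (- s * (y - u)))%:E)%E.
    rewrite -[LHS]oppeK -integral_ge0N; last by move=> y _; rewrite lee_fin.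
    congr (- _)%E; apply: eq_integral => y _.
    by rewrite -EFinN /E mulNr -[- s * (y - u)]mulrNN opprK opprB.
  by rewrite intN -EFinN opprB.
have iF := integrable_convolvand u gu Fb.
have KE : mu.-integrable `[0, u] (EFin \o (fun y => K / s * E y)).
  apply/integrableP; split; first exact/measurable_EFinP/measurable_funTS/measurable_funM.
  under eq_integral.
    move=> y _; rewrite /= ger0_norm; last by rewrite mulr_ge0// divr_ge0// ltW.
    rewrite EFinM.
    over.
  rewrite ge0_integralZl_EFin//=; last 3 first.
  - by move=> y _; rewrite lee_fin.
  - exact/measurable_EFinP/measurable_funTS.
  - by rewrite divr_ge0// ltW.
  by rewrite intE -EFinM ltry.
apply: (le_trans (le_normr_Rintegral _ iF)) => //.
apply: (@le_trans _ _ (\int[mu]_(y in `[0, u]) (K / s * E y))).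
  apply: le_Rintegral => //.
    by apply/integrableP; split; have /integrableP[mf fi] := integrable_norm iF.
  move=> y _; have /andP[g0 g1] := gu.2 y.
  rewrite normrM ger0_norm// /E mulrA divfK ?gt_eqF//.
  by rewrite (le_trans _ (FK (u - y)))// ler_piMl.
rewrite RintegralZl//; last first.
  apply/integrableP; split; first exact/measurable_EFinP/measurable_funTS.
  under eq_integral do rewrite /= ger0_norm//.
  by rewrite intE ltry.
rewrite /Rintegral intE /= ler_wpM2l//; last by rewrite gerBl.
by rewrite divr_ge0// ltW.
Qed.

End renewal_linearity.

(** * Powers of theta c - delta b *)

Section signed_binomial_sums.
Context (R : realType) (theta delta : R).

(** The binomial expansion of (theta c - delta b)^n, with [f k r] in the place of c^k b^r. *)
Definition binomial_sum n (f : nat -> nat -> R) : R :=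
  \sum_(k < n.+1) 'C(n, k)%:R * theta ^+ k * (- delta) ^+ (n - k) * f k (n - k)%N.

Lemma binomial_sum0 f : binomial_sum 0 f = f 0%N 0%N.
Proof. by rewrite /binomial_sum big_ord1 bin0 !expr0 !mul1r. Qed.

Lemma binomial_sumS n f : binomial_sum n.+1 f =
  theta * binomial_sum n (fun k r => f k.+1 r) -
  delta * binomial_sum n (fun k r => f k r.+1).
Proof.
pose a k := 'C(n, k)%:R * theta ^+ k * (- delta) ^+ (n.+1 - k) * f k (n.+1 - k)%N.
(* The sum is padded by k = n + 1, where the binomial coefficient vanishes, so that Pascal's rule
   can be applied term by term. *)
have lastE : \sum_(k < n.+2) a k = - delta * binomial_sum n (fun k r => f k r.+1).
  rewrite big_ord_recr /= /a bin_small// !mul0r addr0 mulr_sumr.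
  apply: eq_bigr => k _; have kn : (k <= n)%N by rewrite -ltnS.
  rewrite subSn// exprS.
  move: ('C(n, k)%:R : R) (theta ^+ k) ((- delta) ^+ (n - k)) (f k (n - k).+1) => x y z t.
  by ring.
rewrite [RHS]addrC -mulNr -lastE [in RHS]big_ord_recl -addrA.
rewrite [LHS]big_ord_recl; congr (_ + _); first by rewrite /a !bin0.
rewrite [in RHS]/binomial_sum mulr_sumr -big_split; apply: eq_bigr => k _.
rewrite /a lift0 binS natrD subSS exprS [RHS]/=.
move: ('C(n, k.+1)%:R : R) ('C(n, k)%:R : R) (f k.+1 (n - k)%N)
  ((- delta) ^+ (n - k)) (theta ^+ k) => x y z v w.
by ring.
Qed.

Lemma binomial_sumB n f h :
  binomial_sum n (fun k r => f k r - h k r) = binomial_sum n f - binomial_sum n h.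
Proof. by rewrite /binomial_sum -sumrB; apply: eq_bigr => k _; rewrite mulrBr. Qed.

(** Each factor theta c - delta b is a difference of two terms of norm at most [q], hence the 2. The
    constant [c] varies in the induction, because shifting an index of [f] multiplies it by q /
    theta or q / delta. *)
Lemma binomial_sum_bound n f (c q : R) : 0 < theta -> 0 < delta -> 0 <= q ->
  (forall k r, theta ^+ k * delta ^+ r * `|f k r| <= c * q ^+ (k + r)) ->
  `|binomial_sum n f| <= c * (2 * q) ^+ n.
Proof.
move=> theta0 delta0 q0; elim: n f c => [|n IH] f c fc.
  by rewrite binomial_sum0; have := fc 0%N 0%N; rewrite !expr0 !mul1r.
rewrite binomial_sumS (le_trans (ler_normB _ _))// !normrM (gtr0_norm theta0) (gtr0_norm delta0).
have IH1 : theta * `|binomial_sum n (fun k r => f k.+1 r)| <= c * q * (2 * q) ^+ n.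
  rewrite -ler_pdivlMl// mulrA; apply: IH => k r.
  rewrite -[leRHS]mulrA ler_pdivlMl// !mulrA -exprS (le_trans (fc _ _))//.
  by rewrite addSn exprS mulrA.
have IH2 : delta * `|binomial_sum n (fun k r => f k r.+1)| <= c * q * (2 * q) ^+ n.
  rewrite -ler_pdivlMl// mulrA; apply: IH => k r.
  rewrite -[leRHS]mulrA ler_pdivlMl//.
  have -> : delta * (theta ^+ k * delta ^+ r * `|f k r.+1|) =
      theta ^+ k * delta ^+ r.+1 * `|f k r.+1| by rewrite exprS; ring.
  by rewrite (le_trans (fc _ _))// addnS exprS mulrA.
apply: (le_trans (lerD IH1 IH2)); rewrite exprS.
by move: ((2 * q) ^+ n) => x; rewrite le_eqVlt; apply/orP; left; apply/eqP; ring.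
Qed.

Lemma renewal_binomial_sum g n (F : nat -> nat -> R -> R) u :
  unit_valued g -> (forall k r, bounded_measurable (F k r)) ->
  renewal g (fun v => binomial_sum n (fun k r => F k r v)) u =
  binomial_sum n (fun k r => renewal g (F k r) u).
Proof.
move=> gu Fb; rewrite /binomial_sum.
rewrite (renewal_sum _ _ gu (F := fun k v =>
  'C(n, k)%:R * theta ^+ k * (- delta) ^+ (n - k) * F k (n - k)%N v)); last first.
  by move=> k; exact: bounded_measurableZ.
by apply: eq_bigr => k _; rewrite renewalZ.
Qed.

Lemma bounded_measurable_binomial_sum n (F : nat -> nat -> R -> R) :
  (forall k r, bounded_measurable (F k r)) ->
  bounded_measurable (fun v => binomial_sum n (fun k r => F k r v)).
Proof.
move=> Fb; apply: (@bounded_measurable_sum _ _ (fun k v =>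
  'C(n, k)%:R * theta ^+ k * (- delta) ^+ (n - k) * F k (n - k)%N v)) => k.
exact: bounded_measurableZ.
Qed.

End signed_binomial_sums.

Lemma geometric_bound_cvg (R : realType) (t : R^nat) (c : R) :
  (forall n, `|t n| <= c * 2^-1 ^+ n) -> t n @[n --> \oo] --> (0 : R).
Proof.
move=> tc; apply/norm_cvg0P.
have h1 : `|2^-1 : R| < 1 by rewrite ger0_norm ?invr_ge0// invf_lt1// ltr1n.
apply: (@squeeze_cvgr _ _ _ _ (fun=> 0) (fun n => c * 2^-1 ^+ n)).
- by apply: nearW => n; rewrite normr_ge0 tc.
- exact: cvg_cst.
- by rewrite -(mulr0 c); apply: cvgMr; exact: cvg_expr.
Qed.

Lemma geometric_bound_series (R : realType) (t : R^nat) (c : R) :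
  (forall n, `|t n| <= c * 2^-1 ^+ n) -> cvgn (series t).
Proof.
move=> tc; apply: normed_cvg.
have h1 : `|2^-1 : R| < 1 by rewrite ger0_norm ?invr_ge0// invf_lt1// ltr1n.
apply: (@series_le_cvg _ _ (geometric c 2^-1)) => [n|n|n|] /=.
- exact: normr_ge0.
- exact: le_trans (normr_ge0 _) (tc n).
- exact: tc.
- exact: is_cvg_geometric_series.
Qed.

(** * The expansion derived from the renewal equations alone *)

Section expansion.
Context (R : realType).
Implicit Types (g F : R -> R) (u v y : R).
Context (lam eps delta theta : R) (gB gC phi : R -> R).
Context (H : nat -> nat -> nat -> R -> R).
Hypotheses (lam_gt0 : 0 < lam) (eps_ge0 : 0 <= eps).
Hypotheses (delta_gt0 : 0 < delta) (theta_gt0 : 0 < theta) (delta_lt1 : delta < 1).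
Hypotheses (gBu : unit_valued gB) (gCu : unit_valued gC).
Hypothesis gmixu : unit_valued (fun y => (1 - eps) * gB y + eps * gC y).
Hypotheses (Hu : forall n m r, unit_valued (H n m r))
  (Hneg : forall n m r, vanish_neg (H n m r)).
Hypothesis H000 : H 0 0 0 = heaviside.
(** [HC], [HB] and [HM] are all that is retained of the sums of copies: the actions of theta c and
    delta b as convolutions, and the equation m0 = (1 - delta) + delta b m0. *)
Hypothesis HC : forall n m r u, theta * H n m.+1 r u = lam * renewal gC (H n m r) u.
Hypothesis HB : forall n m r u, delta * H n m r.+1 u = lam * renewal gB (H n m r) u.
Hypothesis HM : forall n m r u, H n.+1 m r u =
  (1 - delta) * H n m r u + lam * renewal gB (H n.+1 m r) u.
Hypothesis phiu : unit_valued phi.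
Hypothesis phi_neg : vanish_neg phi.
Hypothesis phi_renewal : forall u, phi u =
  (1 - ((1 - eps) * delta + eps * theta)) * heaviside u +
  lam * renewal (fun y => (1 - eps) * gB y + eps * gC y) phi u.

Let W := binomial_sum theta delta.
Let eta := eps / (1 - delta).
(* Against the weight exp (- s u), convolution with theta c or delta b has norm
   at most q; this s makes both q and 2 eta q at most 1/2. *)
Let s := 4 * lam * (1 + eta).
Let q := lam / s.
(* With m0 the law of M_0, D n and E n are the distribution functions of
   m0^(n+1) (theta c - delta b)^n and m0^n (theta c - delta b)^n. *)
Let D n v := W n (fun k r => H n.+1 k r v).
Let E n v := W n (fun k r => H n k r v).

Let delta1 : 0 < 1 - delta. Proof. by rewrite subr_gt0. Qed.

Let eta_ge0 : 0 <= eta. Proof. by rewrite divr_ge0// ltW. Qed.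

Let epsE : eps = (1 - delta) * eta.
Proof. by rewrite /eta mulrCA divff ?mulr1// gt_eqF. Qed.

Let s_gt0 : 0 < s.
Proof. by rewrite !mulr_gt0// ltr_pwDl. Qed.

Let q_ge0 : 0 <= q. Proof. by rewrite divr_ge0// ltW. Qed.

Let qE : q = (4 * (1 + eta))^-1.
Proof.
rewrite /q /s; have := lam_gt0; have : 0 < 1 + eta by rewrite ltr_pwDl.
by move: (1 + eta) => x x0 l0; field; rewrite !gt_eqF.
Qed.

Let q_le : q <= 2^-1.
Proof.
rewrite qE lef_pV2 ?posrE ?mulr_gt0 ?ltr_pwDl//.
by have := eta_ge0; lra.
Qed.

Let qeta_le : eta * (2 * q) <= 2^-1.
Proof.
rewrite qE; have e0 := eta_ge0; have e1 : 0 < 1 + eta by rewrite ltr_pwDl.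
rewrite mulrA ler_pdivrMr ?mulr_gt0// ; lra.
Qed.

Let Hb n m r : bounded_measurable (H n m r).
Proof. exact: unit_valued_bounded. Qed.

Let expR_ge1 v : 0 <= v -> 1 <= expR (s * v).
Proof. by move=> v0; rewrite -expR0 ler_expR mulr_ge0// ltW. Qed.

(** Each copy of C^e or B^e is one application of [lam * renewal], which costs a factor [q]. Without
    such copies, a distribution function is at most 1 <= exp (s v) for v >= 0 and is zero for v <
    0. *)
Let H_bound n m r v :
  theta ^+ m * delta ^+ r * `|H n m r v| <= q ^+ (m + r) * expR (s * v).
Proof.
have t0 := ltW theta_gt0; have d0 := ltW delta_gt0.
have q0 k : 0 <= q ^+ k by exact: exprn_ge0.
have step g F c k w : unit_valued g -> bounded_measurable F -> 0 <= c ->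
    (forall x, c * `|F x| <= q ^+ k * expR (s * x)) ->
    c * `|lam * renewal g F w| <= q ^+ k.+1 * expR (s * w).
  move=> gu Fb c0 Fk.
  have : `|renewal g (fun x => c * F x) w| <= q ^+ k / s * expR (s * w).
    apply: renewal_exp_bound => //; first exact: bounded_measurableZ.
    by move=> x; rewrite normrM ger0_norm.
  rewrite renewalZ// normrM (ger0_norm c0) normrM (gtr0_norm lam_gt0).
  rewrite [c * (lam * _)]mulrCA.
  move=> /(ler_wpM2l (ltW lam_gt0)) /le_trans; apply.
  rewrite exprS /q; move: (expR _) ((lam / s) ^+ k) => x y.
  by rewrite le_eqVlt; apply/orP; left; apply/eqP; ring.
elim: m r v => [|m IH] r v.
  elim: r v => [|r IH] v.
    rewrite !expr0 !mul1r; have [v0|v0] := leP 0 v; last first.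
      by rewrite Hneg// normr0 expR_ge0.
    by rewrite (le_trans (unit_valued_norm_le (Hu n 0 0) v))// expR_ge1.
  have -> : theta ^+ 0 * delta ^+ r.+1 * `|H n 0 r.+1 v| =
      theta ^+ 0 * delta ^+ r * `|lam * renewal gB (H n 0 r) v|.
    by rewrite -HB normrM (gtr0_norm delta_gt0) exprSr !mulrA.
  by rewrite addnS; apply: step => //; rewrite mulr_ge0 ?exprn_ge0.
have -> : theta ^+ m.+1 * delta ^+ r * `|H n m.+1 r v| =
    theta ^+ m * delta ^+ r * `|lam * renewal gC (H n m r) v|.
  by rewrite -HC normrM (gtr0_norm theta_gt0) exprSr mulrA [theta ^+ m * theta * _]mulrAC.
by rewrite addSn; apply: step => //; rewrite mulr_ge0 ?exprn_ge0.
Qed.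

(** The n-th power contributes (2 q)^n, and the choice of [s] makes (eta 2 q)^n at most 2^-n. *)
Let W_H_bound n f v (a : R) : 0 <= a ->
  (forall k r, theta ^+ k * delta ^+ r * `|f k r| <= a * (q ^+ (k + r) * expR (s * v))) ->
  `|eta ^+ n * W n f| <= a * expR (s * v) * 2^-1 ^+ n.
Proof.
move=> a0 fk.
have Wb : `|W n f| <= a * expR (s * v) * (2 * q) ^+ n.
  apply: binomial_sum_bound => // k r.
  by rewrite (le_trans (fk k r))// [q ^+ _ * _]mulrC mulrA.
have e0 : 0 <= eta ^+ n by exact: exprn_ge0.
rewrite normrM ger0_norm// (le_trans (ler_wpM2l e0 Wb))// mulrCA -exprMn.
have qeta0 : 0 <= eta * (2 * q) by apply: mulr_ge0 => //; exact: mulr_ge0.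
by rewrite ler_wpM2l ?mulr_ge0 ?expR_ge0// lerXn2r ?nnegrE ?invr_ge0.
Qed.

Let D_renewal n v : D n v = (1 - delta) * E n v + lam * renewal gB (D n) v.
Proof.
rewrite /D /E /W renewal_binomial_sum// /binomial_sum !mulr_sumr -big_split.
apply: eq_bigr => k _ /=; rewrite {1}HM.
by rewrite mulrDr; congr (_ + _); rewrite mulrCA.
Qed.

Let E_renewal n v : E n.+1 v = lam * renewal gC (D n) v - lam * renewal gB (D n) v.
Proof.
rewrite /E /W binomial_sumS /D !renewal_binomial_sum// /binomial_sum !mulr_sumr.
by congr (_ - _); apply: eq_bigr => k _; rewrite mulrCA ?HC ?HB mulrCA.
Qed.

Let Db n : bounded_measurable (D n).
Proof. exact: bounded_measurable_binomial_sum. Qed.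

Let Psi n v := \sum_(k < n) eta ^+ k * D k v.

Let Psib n : bounded_measurable (Psi n).
Proof.
apply: (@bounded_measurable_sum _ _ (fun k v => eta ^+ k * D k v)) => k.
exact: bounded_measurableZ.
Qed.

(** A telescoping sum: 1 - delta b maps D k to (1 - delta) E k, while eps (theta c - delta b) maps
    it to (1 - delta) eta E (k + 1). After the weights eta^k, only the unit E 0 and the last term
    survive. *)
Let Psi_renewal n v : Psi n v =
  (1 - delta) * heaviside v + lam * renewal gB (Psi n) v +
  eps * (lam * renewal gC (Psi n) v - lam * renewal gB (Psi n) v) -
  (1 - delta) * (eta ^+ n * E n v).
Proof.
have renewal_Psi g m w : unit_valued g ->
    renewal g (Psi m) w = \sum_(k < m) eta ^+ k * renewal g (D k) w.
  move=> gu; rewrite (renewal_sum _ _ gu (F := fun k v => eta ^+ k * D k v)).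
    by apply: eq_bigr => k _; rewrite renewalZ.
  by move=> k; exact: bounded_measurableZ.
rewrite !renewal_Psi//; elim: n => [|n IH].
  rewrite /Psi !big_ord0 !mulr0 expr0 mul1r /E /W binomial_sum0 H000.
  by rewrite subrr mulr0 !addr0 subrr.
have EB := D_renewal n v; have EC := E_renewal n v.
rewrite /Psi big_ord_recr /= -/(Psi n v) IH !big_ord_recr /= {1}EB EC exprS.
move: (\sum_(i < n) _) (\sum_(i < n) _) (eta ^+ n) (E n v) => x y a b.
move: (renewal gB (D n) v) (renewal gC (D n) v) (heaviside v) => c e h.
by rewrite epsE; ring.
Qed.

(** Equal to (1 - rho) / (1 - delta), by [load_kappa]: it converts the atom of the base equation
    into that of the perturbed one. *)
Let kappa := 1 - eta * (theta - delta).

Let z n v := kappa * Psi n v - phi v.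

Let load_kappa : 1 - ((1 - eps) * delta + eps * theta) = kappa * (1 - delta).
Proof. by rewrite /kappa epsE; ring. Qed.

Let zb n : bounded_measurable (z n).
Proof.
have -> : z n = fun v => kappa * Psi n v + -1 * phi v.
  by apply/funext => v; rewrite mulN1r.
by apply: bounded_measurableD; apply: bounded_measurableZ => //; exact: unit_valued_bounded.
Qed.

(** By the choice of [kappa] the [heaviside] terms of the two renewal equations cancel, leaving a
    homogeneous equation up to the truncation residue. *)
Let z_renewal n v : z n v =
  lam * renewal (fun y => (1 - eps) * gB y + eps * gC y) (z n) v -
  kappa * (1 - delta) * (eta ^+ n * E n v).
Proof.
have phib := unit_valued_bounded phiu.
have -> : renewal (fun y => (1 - eps) * gB y + eps * gC y) (z n) v =
    kappa * ((1 - eps) * renewal gB (Psi n) v + eps * renewal gC (Psi n) v) -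
    renewal (fun y => (1 - eps) * gB y + eps * gC y) phi v.
  have -> : z n = fun v => kappa * Psi n v + -1 * phi v.
    by apply/funext => w; rewrite mulN1r.
  rewrite renewalD//; [|exact: bounded_measurableZ..].
  by rewrite !renewalZ// mulN1r renewal_mixture.
rewrite /z {1}Psi_renewal {1}phi_renewal load_kappa.
move: (renewal gB (Psi n) v) (renewal gC (Psi n) v) (renewal _ phi v) => a b c.
by move: (eta ^+ n) (E n v) (heaviside v) => x y h; ring.
Qed.

Let z_neg n v : v < 0 -> z n v = 0.
Proof.
move=> v0; rewrite /z phi_neg// subr0 /Psi big1 ?mulr0// => k _.
by rewrite /D /W /binomial_sum big1 ?mulr0// => j _; rewrite Hneg// mulr0.
Qed.

(* z n solves z = A z + r with A of norm at most 1/2 and r small. *)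
Let z_bound n v : `|z n v| <= 2 * `|kappa * (1 - delta)| * expR (s * v) * 2^-1 ^+ n.
Proof.
set K := `|kappa * (1 - delta)|.
have K0 : 0 <= K by exact: normr_ge0.
have h0 k : 0 <= (2^-1 : R) ^+ k by rewrite exprn_ge0// invr_ge0.
have rb w : `|kappa * (1 - delta) * (eta ^+ n * E n w)| <= K * 2^-1 ^+ n * expR (s * w).
  rewrite normrM -mulrA ler_wpM2l// [leRHS]mulrC.
  have := @W_H_bound n (fun k r => H n k r w) w 1 ler01.
  by rewrite mul1r; apply => k r; rewrite mul1r.
have [_ [c zc]] := zb n.
have c0 : 0 <= c by exact: le_trans (normr_ge0 _) (zc 0).
(* Starting from the constant bound [c], each use of the equation sends a bound x to at most x / 2 +
   K 2^-n, whose fixed point is 2 K 2^-n. For w < 0 the constant is not below the weight, but [z]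
   vanishes there. *)
have iter j : forall w, `|z n w| <= (c * 2^-1 ^+ j + 2 * (K * 2^-1 ^+ n)) * expR (s * w).
  elim: j => [|j IH] w.
    have [w0|w0] := leP 0 w; last first.
      by rewrite z_neg// normr0 mulr_ge0 ?expR_ge0// !addr_ge0 ?mulr_ge0.
    rewrite expr0 mulr1 (le_trans (zc w))//.
    rewrite -[leLHS]mulr1 ler_pM ?expR_ge1// lerDl !mulr_ge0//.
  rewrite z_renewal (le_trans (ler_normB _ _))//.
  set X := c * 2^-1 ^+ j + 2 * (K * 2^-1 ^+ n) in IH.
  have X0 : 0 <= X by rewrite addr_ge0 ?mulr_ge0.
  have := ler_wpM2l (ltW lam_gt0) (renewal_exp_bound s_gt0 X0 gmixu (zb n) IH w).
  rewrite -[X in X * `|_|](gtr0_norm lam_gt0) -normrM => IHw.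
  rewrite (le_trans (lerD IHw (rb w)))//.
  have -> : lam * (X / s * expR (s * w)) = q * X * expR (s * w).
    by rewrite mulrA; congr (_ * _); rewrite mulrA mulrAC.
  rewrite -mulrDl ler_wpM2r ?expR_ge0//.
  have := ler_wpM2r X0 q_le.
  by rewrite /X exprS; move: (2^-1 ^+ j) (2^-1 ^+ n) (q * _) => x y t; lra.
have lim : (c * 2^-1 ^+ j + 2 * (K * 2^-1 ^+ n)) * expR (s * v) @[j --> \oo] -->
    (c * 0 + 2 * (K * 2^-1 ^+ n)) * expR (s * v).
  apply: cvgMl; apply: cvgD; last exact: cvg_cst.
  apply: cvgMr; apply: cvg_expr.
  by rewrite ger0_norm ?invr_ge0// invf_lt1// ltr1n.
rewrite mulr0 add0r in lim.
apply: (@le_trans _ _ (2 * (K * 2^-1 ^+ n) * expR (s * v))).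
  by apply: (cvgr_to_ge lim); apply: nearW => j; exact: iter.
by rewrite [2 * (K * _)]mulrA [leRHS]mulrAC.
Qed.

Lemma expansion_Psi u : kappa * Psi n u @[n --> \oo] --> phi u.
Proof.
have z0 : z n u @[n --> \oo] --> (0 : R).
  exact: (geometric_bound_cvg (z_bound ^~ u)).
have -> : (fun n => kappa * Psi n u) = (fun n => z n u + phi u).
  by apply/funext => n; rewrite subrK.
by rewrite -[X in _ --> X]add0r; apply: cvgD => //; exact: cvg_cst.
Qed.

Context (L : nat -> nat -> nat -> R -> R).
Hypothesis LE : forall j m r u, L j m r u = 1 - H j.+1 m r u.

Let termC u n := eta ^+ n *
  \sum_(0 <= k < n) 'C(n - 1, k)%:R * theta ^+ k * (- delta) ^+ (n - 1 - k) *
    (L n k.+1 (n - 1 - k)%N u - L (n - 1)%N k (n - 1 - k)%N u).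
Let termB u n := eta ^+ n *
  \sum_(0 <= k < n) 'C(n - 1, k)%:R * theta ^+ k * (- delta) ^+ (n - 1 - k) *
    (L n k (n - k)%N u - L (n - 1)%N k (n - 1 - k)%N u).

Let termCE u n : termC u n.+1 = eta * (eta ^+ n *
  W n (fun k r => H n.+1 k r u - H n.+2 k.+1 r u)).
Proof.
rewrite /termC exprS -mulrA subn1 /= big_mkord; congr (_ * (_ * _)).
by apply: eq_bigr => k _; rewrite !LE; congr (_ * _); lra.
Qed.

Let termBE u n : termB u n.+1 = eta * (eta ^+ n *
  W n (fun k r => H n.+1 k r u - H n.+2 k r.+1 u)).
Proof.
rewrite /termB exprS -mulrA subn1 /= big_mkord; congr (_ * (_ * _)).
apply: eq_bigr => k _; have kn : (k <= n)%N by rewrite -ltnS.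
by rewrite !LE subSn//; congr (_ * _); lra.
Qed.

Let c1 u := (1 + q / theta + q / delta) * expR (s * u).

(** The subtracted term has one more copy of C^e or B^e than the weight in front accounts for, hence
    q / theta or q / delta; their sum serves both series. *)
Let diff_bound u k r n (x : R) : theta ^+ k * delta ^+ r * `|x| <=
    (q / theta + q / delta) * (q ^+ (k + r) * expR (s * u)) ->
  theta ^+ k * delta ^+ r * `|H n k r u - x| <=
    (1 + q / theta + q / delta) * (q ^+ (k + r) * expR (s * u)).
Proof.
move=> xb; have hb := H_bound n k r u.
have tk : 0 <= theta ^+ k * delta ^+ r by rewrite mulr_ge0 ?exprn_ge0 ?ltW.
apply: (le_trans (ler_wpM2l tk (ler_normB _ _))).
by rewrite mulrDr (le_trans (lerD hb xb))// -[1 + _ + _]addrA [leRHS]mulrDl mul1r.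
Qed.

Let coef_ge0 : 0 <= 1 + q / theta + q / delta.
Proof. by rewrite !addr_ge0 ?divr_ge0 ?ltW. Qed.

Let termC_bound u n : `|termC u n.+1| <= eta * c1 u * 2^-1 ^+ n.
Proof.
rewrite termCE normrM ger0_norm// -mulrA ler_wpM2l//.
apply: W_H_bound => // k r; apply: diff_bound.
have tk : 0 <= q ^+ (k + r) * expR (s * u) by rewrite mulr_ge0 ?exprn_ge0 ?expR_ge0.
apply: (@le_trans _ _ (q / theta * (q ^+ (k + r) * expR (s * u)))).
  rewrite [q / theta]mulrC -[leRHS]mulrA ler_pdivlMl//.
  have := H_bound n.+2 k.+1 r u.
  by rewrite addSn !exprS !mulrA.
by rewrite ler_wpM2r// lerDl divr_ge0// ltW.
Qed.

Let termB_bound u n : `|termB u n.+1| <= eta * c1 u * 2^-1 ^+ n.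
Proof.
rewrite termBE normrM ger0_norm// -mulrA ler_wpM2l//.
apply: W_H_bound => // k r; apply: diff_bound.
have tk : 0 <= q ^+ (k + r) * expR (s * u) by rewrite mulr_ge0 ?exprn_ge0 ?expR_ge0.
apply: (@le_trans _ _ (q / delta * (q ^+ (k + r) * expR (s * u)))).
  rewrite [q / delta]mulrC -[leRHS]mulrA ler_pdivlMl//.
  have := H_bound n.+2 k r.+1 u.
  by rewrite addnS !exprS !mulrA [delta * _]mulrC [theta ^+ k * delta * _]mulrAC.
by rewrite ler_wpM2r// lerDr divr_ge0// ltW.
Qed.

Let shift_series (t : R^nat) m : \sum_(1 <= n < m.+1) t n = series (fun n => t n.+1) m.
Proof. by rewrite /series /= big_add1. Qed.

Lemma replace_expansion u :
  let partialC m := \sum_(1 <= n < m) termC u n in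
  let partialB m := \sum_(1 <= n < m) termB u n in
  [/\ cvgn partialC, cvgn partialB &
      H 1 0 0 u - phi u = theta * limn partialC - delta * limn partialB].
Proof.
move=> partialC partialB.
have shift (t : R^nat) c : (forall n, `|t n.+1| <= c * 2^-1 ^+ n) ->
    cvgn (fun m => \sum_(1 <= n < m) t n).
  move=> tc; have /cvg_ex[l sl] := geometric_bound_series tc.
  apply/cvg_ex; exists l; rewrite -cvg_shiftS.
  by under eq_fun do rewrite shift_series.
have cvC := shift _ _ (termC_bound u); have cvB := shift _ _ (termB_bound u).
split=> //.
(* The regrouping: the combined term of index k + 1 is eta^(k+1) ((theta - delta) D k - D (k + 1)).
   Summing for k < m gives D 0 - kappa Psi m - eta^m D m, where D 0 is H 1 0 0. *)
have sumE m : theta * partialC m.+1 - delta * partialB m.+1 =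
    H 1 0 0 u - kappa * Psi m u - eta ^+ m * D m u.
  rewrite /partialC /partialB !shift_series /series /= !big_mkord.
  elim: m => [|m IH].
    by rewrite /Psi !big_ord0 /D /W binomial_sum0 !mulr0 !subr0 mul1r subrr.
  rewrite !big_ord_recr /= !mulrDr opprD addrACA IH /Psi big_ord_recr /= -/(Psi m u).
  rewrite termCE termBE /W !binomial_sumB exprS.
  have := binomial_sumS theta delta m (fun k r => H m.+2 k r u).
  rewrite -/W -/(D m u) -/(D m.+1 u) /kappa.
  move: (W m _) (W m _) => x y ->.
  by move: (D m u) (Psi m u) (eta ^+ m) (H 1 0 0 u) => a b c e; ring.
have lim1 : theta * partialC m.+1 - delta * partialB m.+1 @[m --> \oo] -->
    theta * limn partialC - delta * limn partialB.
  by apply: cvgB; apply: cvgMr; [rewrite (cvg_shiftS partialC)|rewrite (cvg_shiftS partialB)].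
apply: (cvg_unique _ _ lim1); first exact: Rhausdorff.
rewrite /= (_ : (fun m => _) = fun m => H 1 0 0 u - kappa * Psi m u - eta ^+ m * D m u).
  rewrite -[X in _ --> X]subr0; apply: cvgB.
    by apply: cvgB; [exact: cvg_cst|exact: expansion_Psi].
  apply: (@geometric_bound_cvg _ _ (1 * expR (s * u))) => n.
  by apply: W_H_bound => // k r; rewrite mul1r.
by apply/funext => m; exact: sumE.
Qed.

End expansion.

Theorem theorem2 (R : realType) (d : measure_display) (Omega : measurableType d)
    (P : probability Omega R) (lambda eps delta theta : R)
    (B C : {RV P >-> R})
    (N N0 : R -> Omega -> nat) (U U0 : nat -> {RV P >-> R})
    (M0c Ce Be : nat -> {RV P >-> R})
    (lambda_gt0 : 0 < lambda) (eps_ge0 : 0 <= eps) (eps_le1 : eps <= 1)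
    (B_ge0 : {ae P, forall w, 0 <= B w}) (C_ge0 : {ae P, forall w, 0 <= C w})
    (B_phase_type : phase_type B) (C_heavy_tailed : heavy_tailed C)
    (EB_gt0 : (0 < 'E_P[B])%E) (EB_fin : ('E_P[B] < +oo)%E)
    (EC_gt0 : (0 < 'E_P[C])%E) (EC_fin : ('E_P[C] < +oo)%E)
    (deltaE : delta = lambda * fine 'E_P[B])
    (thetaE : theta = lambda * fine 'E_P[C])
    (rho_lt1 : (1 - eps) * delta + eps * theta < 1) (delta_lt1 : delta < 1)
    (model : cramer_lundberg lambda eps B C N U)
    (base_model : cramer_lundberg lambda 0 B C N0 U0)
    (M0c_law : forall i,
      same_law P (EFin \o M0c i) (max_loss N0 (fun j => U0 j : Omega -> R)))
    (Ce_law : forall i, stationary_excess C (Ce i))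
    (Be_law : forall i, stationary_excess B (Be i))
    (copies_indep : independent_RVs (join2 (join2 M0c Ce) Be))
    (small_eps : eps < `|1 - delta| / Num.max delta theta) :
  let psi_eps := ruin_prob P N (fun j => U j : Omega -> R) in
  let psi_0 := ruin_prob P N0 (fun j => U0 j : Omega -> R) in
  let L := sum_tail P (fun i => M0c i : Omega -> R) (fun i => Ce i : Omega -> R)
                      (fun i => Be i : Omega -> R) in
  let termC (u : R) (n : nat) := (eps / (1 - delta)) ^+ n *
    \sum_(0 <= k < n) 'C(n - 1, k)%:R * theta ^+ k * (- delta) ^+ (n - 1 - k) *
      (L n k.+1 (n - 1 - k)%N u - L (n - 1)%N k (n - 1 - k)%N u) in
  let termB (u : R) (n : nat) := (eps / (1 - delta)) ^+ n *
    \sum_(0 <= k < n) 'C(n - 1, k)%:R * theta ^+ k * (- delta) ^+ (n - 1 - k) *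
      (L n k (n - k)%N u - L (n - 1)%N k (n - 1 - k)%N u) in
  let partialC (u : R) (m : nat) := \sum_(1 <= n < m) termC u n in
  let partialB (u : R) (m : nat) := \sum_(1 <= n < m) termB u n in
  forall u : R, 0 <= u ->
    [/\ cvgn (partialC u), cvgn (partialB u) &
        psi_eps u = psi_0 u + theta * limn (partialC u)
                            - delta * limn (partialB u)].
Proof.
move=> psi_eps psi_0 L termC termB partialC partialB u u0.
have EB0 : 0 < fine 'E_P[B] by rewrite fine_gt0// EB_gt0.
have EC0 : 0 < fine 'E_P[C] by rewrite fine_gt0// EC_gt0.
have delta_gt0 : 0 < delta by rewrite deltaE mulr_gt0.
have theta_gt0 : 0 < theta by rewrite thetaE mulr_gt0.
have gBu := unit_valued_ccdfr P (@measurable_funPT _ _ _ _ B).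
have gCu := unit_valued_ccdfr P (@measurable_funPT _ _ _ _ C).
have load_lt1 : claim_load lambda eps B C < 1.
  by rewrite /claim_load -deltaE -thetaE.
(* The base model is the mixture with eps = 0, so a single Pollaczek-Khinchine lemma serves both
   models. *)
have load0E : claim_load lambda 0 B C = delta.
  by rewrite /claim_load -deltaE mul0r addr0 subr0 mul1r.
have load0_lt1 : claim_load lambda 0 B C < 1 by rewrite load0E.
have [phiu phi_neg _ phiE] := pollaczek_khinchine lambda_gt0 eps_ge0 eps_le1
  B_ge0 C_ge0 EB_fin EC_fin model load_lt1.
have [phi0u phi0_neg ruin0 phi0E] := pollaczek_khinchine lambda_gt0 (lexx 0) ler01
  B_ge0 C_ge0 EB_fin EC_fin base_model load0_lt1.
(* The maximum is extended-real and its copies are real, so the laws are compared on the extended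
   half-line above [v]. *)
have M0cE i v : cdfr P (M0c i) v = 1 - psi_0 v.
  have mM : measurable_fun setT (M0c i) by exact: measurable_funPT.
  have -> : psi_0 v = ccdfr P (M0c i) v.
    apply: EFin_inj; rewrite ccdfrE// -ruin0.
    have mv : measurable [set x : \bar R | (v%:E < x)%E].
      rewrite (_ : mkset _ = [set` `]v%:E, +oo[]); first exact: emeasurable_itv.
      by apply/seteqP; split => x /=; rewrite in_itv/= andbT.
    exact/esym/(M0c_law i _ mv).
  by rewrite ccdfr_1_cdfr// opprB addrC subrK.
have M0c_ge0 i : {ae P, forall w, 0 <= M0c i w}.
  by apply: vanish_neg_ae_ge0 => v v0; rewrite M0cE phi0_neg.
have Ce_ge0 i := stationary_excess_ge0 (ltW EC0) (Ce_law i).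
have Be_ge0 i := stationary_excess_ge0 (ltW EB0) (Be_law i).
have M0c_renewal i v : cdfr P (M0c i) v =
    (1 - delta) * heaviside v + lambda * renewal (ccdfr P B) (cdfr P (M0c i)) v.
  have -> : cdfr P (M0c i) = fun v => 1 - psi_0 v by apply/funext => x; exact: M0cE.
  rewrite phi0E load0E; congr (_ + _ * renewal _ _ _); apply/funext => y.
  by rewrite /mixture_survival subr0 mul1r mul0r addr0.
have HC n m r v : theta * copies_cdf M0c Ce Be n m.+1 r v =
    lambda * renewal (ccdfr P C) (copies_cdf M0c Ce Be n m r) v.
  have Ce_cdf := stationary_excess_cdfr (ltW EC0) (Ce_law m).
  rewrite (copies_cdf_Ce copies_indep M0c_ge0 Ce_ge0 Be_ge0 _ _ _ gCu _ Ce_cdf).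
    by rewrite thetaE -mulrA mulVKf ?gt_eqF.
  by rewrite invr_ge0 ltW.
have HB n m r v : delta * copies_cdf M0c Ce Be n m r.+1 v =
    lambda * renewal (ccdfr P B) (copies_cdf M0c Ce Be n m r) v.
  have Be_cdf := stationary_excess_cdfr (ltW EB0) (Be_law r).
  rewrite (copies_cdf_Be copies_indep M0c_ge0 Ce_ge0 Be_ge0 _ _ _ gBu _ Be_cdf).
    by rewrite deltaE -mulrA mulVKf ?gt_eqF.
  by rewrite invr_ge0 ltW.
have HM n m r v : copies_cdf M0c Ce Be n.+1 m r v =
    (1 - delta) * copies_cdf M0c Ce Be n m r v +
    lambda * renewal (ccdfr P B) (copies_cdf M0c Ce Be n.+1 m r) v.
  apply: (copies_cdf_M0 copies_indep M0c_ge0 Ce_ge0 Be_ge0 _ _ _ gBu _ _ (M0c_renewal n)).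
    by rewrite subr_ge0 ltW.
  exact: ltW.
have phi_renewal v : 1 - psi_eps v =
    (1 - ((1 - eps) * delta + eps * theta)) * heaviside v +
    lambda * renewal (mixture_survival eps B C) (fun v => 1 - psi_eps v) v.
  by rewrite phiE /claim_load -deltaE -thetaE.
have [cvC cvB sumE] := replace_expansion lambda_gt0 eps_ge0 delta_gt0 theta_gt0
  delta_lt1 gBu gCu (unit_valued_mixture_survival B C eps_ge0 eps_le1)
  (unit_valued_copies_cdf M0c Ce Be) (vanish_neg_copies_cdf M0c_ge0 Ce_ge0 Be_ge0)
  (copies_cdf0 M0c Ce Be) HC HB HM phiu phi_neg phi_renewal
  (sum_tail_cdf M0c Ce Be) u.
split; [exact: cvC|exact: cvB|].
(* A single copy of M_0 alone: this is where the leading term psi_0 enters. *)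
have H100 : copies_cdf M0c Ce Be 1 0 0 u = 1 - psi_0 u.
  rewrite -(M0cE 0%N) /copies_cdf; congr cdfr; apply/funext => w.
  by rewrite /copies_sum big_ord1 !big_ord0 !addr0.
rewrite H100 /= in sumE.
rewrite -addrA -[X in _ = _ + X]sumE.
have arith (a b : R) : b = a + (1 - a - (1 - b)) by ring.
exact: arith.
Qed.
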